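(* Let $\mathcal W$ be a flag in $\mathbb R^n$ and let $\Delta(\mathcal W)\subset S^{far}$ be the set of all finite pencils of geodesics in $\mathbb E_n$ whose limit flag is $\mathcal W$. Then the closure of $\Delta(\mathcal W)$ in the sphere at infinity $S^{far}$ is $$\bigcup_{\mathcal W'\subset\mathcal W}\Delta(\mathcal W'),$$ where $\mathcal W'$ ranges over all subflags of $\mathcal W$.
   Context: $\mathbb E_n$ is the space of real positive definite symmetric $n\times n$ matrices with the metric $ds^2=\mathrm{tr}(dX\,X^{-1}\,dX\,X^{-1})$ and geodesic distance $\rho$. Its (nonconstant) geodesics are the curves $\mu(t)=g\,\mathrm{diag}(e^{\varphi_1t},\dots,e^{\varphi_nt})g^\top$, $g\in\mathrm{GL}(n,\mathbb R)$, $\varphi_1\ge\dots\ge\varphi_n$, $\varphi\ne0$; they are directed and considered up to $t\mapsto at+b$, $a>0$. Two directed geodesics $\mu,\nu$ lie in one finite pencil if $\lim_{t\to+\infty}\inf_{s\ge0}\rho(\mu(t),\nu(s))$ exists and is finite. A flag is a chain $\mathbb R^n=W_0\supsetneq W_1\supsetneq\dots\supsetneq W_m=0$, $m\ge1$; a subflag is obtained by deleting some of the intermediate subspaces $W_1,\dots,W_{m-1}$ (possibly none or all of them). The limit flag of $\mu$: let $\psi_1>\dots>\psi_m$ be the distinct values among $\varphi_j$, with multiplicities $\alpha_1,\dots,\alpha_m$, $i_k=\alpha_1+\dots+\alpha_k$; then $W_k=\{v\in\mathbb R^n:(g^\top v)_j=0\ \forall j\le i_k\}$. All geodesics of one finite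 pencil have the same limit flag. Sphere at infinity $S^{far}$: the set of all finite pencils. Each finite pencil contains exactly one geodesic through the point $E$ (identity matrix), so $S^{far}$ is identified with the set of rays in the tangent space $T_E\mathbb E_n$ (the space of symmetric $n\times n$ matrices) and has the corresponding topology of a sphere. *)

(* Defs.v *)
From HB Require Import structures.
From mathcomp Require Import all_boot all_order all_algebra.
From mathcomp Require Import all_classical all_reals all_analysis.

Set Implicit Arguments.
Unset Strict Implicit.
Unset Printing Implicit Defensive.

Import Order.TTheory GRing.Theory Num.Theory.
Import numFieldNormedType.Exports.

Local Open Scope classical_set_scope.
Local Open Scope ring_scope.

Section PositiveDefiniteMatrices.
Context {R : realType} {n : nat}.

Definition posdef (X : 'M[R]_n) : Prop :=
  X^T = X /\ forall v : 'cV[R]_n, v != 0 -> 0 < (v^T *m X *m v) 0 0.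

(* A C^1 arc is parametrized by [0, 1].  The curve is C^1 on the whole line but
   only its restriction to [0, 1] matters: every function which is C^1 on
   [0, 1], with one-sided derivatives at the endpoints, extends affinely to a
   C^1 function on the line. *)
Definition C1_arc (gamma : R -> 'M[R]_n) : Prop :=
  [/\ forall t, derivable gamma t 1,
      continuous (derive1 gamma) &
      forall t, 0 <= t <= 1 -> posdef (gamma t)].

(* The length for the metric tr(dX X^-1 dX X^-1). *)
Definition arc_length (gamma : R -> 'M[R]_n) : R :=
  \int[lebesgue_measure]_(t in `[0, 1])
    Num.sqrt (\tr (derive1 gamma t *m invmx (gamma t) *m
                   derive1 gamma t *m invmx (gamma t))).

(* [path_length X Y L]: some piecewise C^1 path from X to Y, i.e. a finite
   concatenation of C^1 arcs, has length L. *)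
Inductive path_length : 'M[R]_n -> 'M[R]_n -> R -> Prop :=
| path_nil X : path_length X X 0
| path_cons gamma Y L :
    C1_arc gamma -> path_length (gamma 1) Y L ->
    path_length (gamma 0) Y (arc_length gamma + L).

(* Riemannian distance; only meaningful at positive definite points. *)
Definition rho (X Y : 'M[R]_n) : R := inf [set L | path_length X Y L].

Definition nonincreasing_row (phi : 'rV[R]_n) : Prop :=
  forall i j : 'I_n, (i <= j)%N -> phi 0 j <= phi 0 i.

(* [geodesic_rep mu g phi]: mu is the nonconstant geodesic
   t |-> g diag(e^(phi_1 t), ..., e^(phi_n t)) g^T. *)
Definition geodesic_rep (mu : R -> 'M[R]_n) (g : 'M[R]_n) (phi : 'rV[R]_n) :
    Prop :=
  [/\ g \in unitmx, nonincreasing_row phi, phi != 0 &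
      forall t, mu t = g *m diag_mx (\row_j expR (phi 0 j * t)) *m g^T].

Definition geodesic (mu : R -> 'M[R]_n) : Prop :=
  exists g phi, geodesic_rep mu g phi.

Definition reparam (mu : R -> 'M[R]_n) : set (R -> 'M[R]_n) :=
  [set nu | exists a b : R, 0 < a /\ nu = (fun t => mu (a * t + b))].

(* A directed geodesic is the set of all its parametrizations. *)
Definition directed_geodesic (l : set (R -> 'M[R]_n)) : Prop :=
  exists2 mu, geodesic mu & l = reparam mu.

Definition dist_to_ray (X : 'M[R]_n) (nu : R -> 'M[R]_n) : R :=
  inf [set rho X (nu s) | s in [set s : R | 0 <= s]].

Definition asymptotic (mu nu : R -> 'M[R]_n) : Prop :=
  exists d : R, dist_to_ray (mu t) nu @[t --> +oo] --> d.

(* The choice of the parametrizations is immaterial. *)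
Definition same_finite_pencil (l m : set (R -> 'M[R]_n)) : Prop :=
  exists mu nu, [/\ l mu, m nu & asymptotic mu nu].

Definition finite_pencil (P : set (set (R -> 'M[R]_n))) : Prop :=
  exists2 l, directed_geodesic l &
    P = [set m | directed_geodesic m /\ same_finite_pencil l m].

(* [W_0; ...; W_m] with R^n = W_0 > W_1 > ... > W_m = 0 and m >= 1. *)
Definition flag (W : seq {vspace 'cV[R]_n}) : Prop :=
  [/\ (1 < size W)%N,
      head 0%VS W = fullv,
      last fullv W = 0%VS &
      sorted (fun U V : {vspace 'cV[R]_n} => (V <= U)%VS && (V != U)) W].

(* Both ends of a flag are forced, so that a subsequence of W which is a flag
   omits intermediate subspaces only. *)
Definition subflag (W' W : seq {vspace 'cV[R]_n}) : Prop :=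
  flag W' /\ subseq W' W.

Definition exponents (phi : 'rV[R]_n) : seq R :=
  [seq phi 0 j | j <- enum 'I_n].

(* psi_1 > ... > psi_m, in this order when phi is nonincreasing. *)
Definition distinct_exponents (phi : 'rV[R]_n) : seq R := undup (exponents phi).

(* i_k = alpha_1 + ... + alpha_k, the alpha's being the multiplicities of the
   psi's; i_0 = 0. *)
Definition cumul_mult (phi : 'rV[R]_n) (k : nat) : nat :=
  (\sum_(psi <- take k (distinct_exponents phi))
     count_mem psi (exponents phi))%N.

(* W_k = {v | (g^T v)_j = 0 for all j <= i_k}, 0 <= k <= m; the coordinates
   are numbered from 0 here, hence the strict inequality. *)
Definition limit_flag_rep (g : 'M[R]_n) (phi : 'rV[R]_n)
    (W : seq {vspace 'cV[R]_n}) : Prop :=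
  size W = (size (distinct_exponents phi)).+1 /\
  forall k : nat, (k < size W)%N -> forall v : 'cV[R]_n,
    v \in nth 0%VS W k <->
    forall j : 'I_n, (j < cumul_mult phi k)%N -> (g^T *m v) j 0 = 0.

(* The flag depends neither on the parametrization nor on (g, phi). *)
Definition limit_flag (l : set (R -> 'M[R]_n)) (W : seq {vspace 'cV[R]_n}) :
    Prop :=
  exists mu g phi, [/\ l mu, geodesic_rep mu g phi & limit_flag_rep g phi W].

End PositiveDefiniteMatrices.

Definition pencil (R : realType) (n : nat) : Type :=
  {P : set (set (R -> 'M[R]_n)) | finite_pencil P}.

HB.instance Definition _ (R : realType) (n : nat) := gen_eqMixin (pencil R n).
HB.instance Definition _ (R : realType) (n : nat) :=
  gen_choiceMixin (pencil R n).

(* Unit vectors of T_E are symmetric A with tr(A A) = 1; each ray of T_E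
   contains exactly one of them.  [unit_velocity_at_E P A] says that A is the
   velocity at E of a geodesic of the pencil P through E. *)
Definition unit_velocity_at_E (R : realType) (n : nat) (P : pencil R n)
    (A : 'M[R]_n) : Prop :=
  exists l mu, [/\ sval P l, l mu, mu 0 = 1%:M, derive1 mu 0 = A
                 & \tr (A *m A) = 1].

(* Each pencil contains exactly one geodesic through E, so that this is an
   injection whose image is the unit sphere of T_E; the default value 0 of
   [xget] is never used. *)
Definition unit_velocity (R : realType) (n : nat) (P : pencil R n) : 'M[R]_n :=
  xget 0 [set A | unit_velocity_at_E P A].

(* The set of all finite pencils, with the topology transported from the unit
   sphere of T_E, i.e. from the space of rays. *)
Definition Sfar (R : realType) (n : nat) := initial_topology (@unit_velocity R n).
HB.instance Definition _ (R : realType) (n : nat) :=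
  Topological.on (Sfar R n).

Definition Delta (R : realType) (n : nat) (W : seq {vspace 'cV[R]_n}) :
    set (Sfar R n) :=
  [set P : pencil R n | forall l, sval P l -> limit_flag l W].

(* Main.v *)
Require Import Defs.
From mathcomp Require Import all_boot all_order all_algebra.
From mathcomp Require Import all_classical all_reals all_analysis.
From mathcomp Require Import ring lra.

(* For v <> 0, |ln v^T X v - ln v^T Y v| <= rho(X, Y).  Along the geodesic
   mu(t) = g diag(e^(phi_j t)) g^T, ln v^T mu(t) v = lam(v) t + O(1), where
   lam(v) is the largest phi_j with (g^T v)_j <> 0; hence, up to a common
   positive factor, lam is constant on a finite pencil.  The subspaces
   {lam <= c} are exactly the members of the limit flag, so all geodesics of a
   pencil have the same limit flag, and the geodesic through E is unique.
   It exists by the decomposition g = k b^T with k orthogonal and b lower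
   triangular: mu is asymptotic to t |-> k diag(e^(phi_j t)) k^T, because
   diag(e^(-phi_j t/2)) b^T diag(e^(phi_j t/2)) converges.

   Now fix an orthonormal basis k adapted to W.  The velocities at E of the
   pencils of Delta(W) are the unit matrices k diag(phi) k^T with phi
   nonincreasing and jumping exactly at the steps of W; the closure consists of
   those where phi is nonincreasing and jumps at some of the steps of W. *)

Set Implicit Arguments.
Unset Strict Implicit.
Unset Printing Implicit Defensive.

Import Order.TTheory GRing.Theory Num.Theory.
Import numFieldNormedType.Exports.

Local Open Scope classical_set_scope.
Local Open Scope ring_scope.

(** * Cholesky and QR decompositions *)

(** The distance [rho] is never computed and the geodesics are never shown to be minimizing:
    quadratic forms bound it from below, straight segments from above, and the triangle inequality
    and congruence invariance do the rest. The time s(t) at which a second geodesic stays close to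
    mu(t) is unknown, but it is the same for every v; one vector of nonzero exponent calibrates it,
    whence the common factor. The relation [asymptotic] asks for the existence of a limit, so its
    symmetry and transitivity are not at hand; geodesics of a pencil are compared through their
    sublevel sets up to scaling instead. One orthonormal k serves all subflags of W: a geodesic
    through E whose sublevel sets belong to W can be rewritten in k, because sublevel sets and
    orthonormality together determine its matrices. *)

Section CholeskyQR.
Variable R : realType.

Lemma posdef_gram n (g : 'M[R]_n) : g \in unitmx -> posdef (g *m g^T).
Proof.
move=> gu; split=> [|v v0]; first by rewrite trmx_mul trmxK.
have -> : v^T *m (g *m g^T) *m v = (g^T *m v)^T *m (g^T *m v).
  by rewrite trmx_mul trmxK !mulmxA.
rewrite mxE; set w := g^T *m v.
have w0 : w != 0.
  apply: contra v0 => /eqP w0; apply/eqP.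
  by rewrite -[v](@mulKmx _ _ _ g^T) ?unitmx_tr// -/w w0 mulmx0.
have [i wi] : exists i, w i 0 != 0.
  apply/existsP; apply: contraR w0; rewrite negb_exists => /forallP w0.
  apply/eqP/matrixP => i j; rewrite ord1 [RHS]mxE; apply/eqP.
  by have := w0 i; rewrite negbK.
rewrite (bigD1 i)//= ltr_pwDl// ?[w^T _ _]mxE -?expr2 ?exprn_even_gt0//.
by apply: sumr_ge0 => j _; rewrite [w^T _ _]mxE -expr2 sqr_ge0.
Qed.

Lemma posdef_congr n (h X : 'M[R]_n) : h \in unitmx -> posdef X ->
  posdef (h *m X *m h^T).
Proof.
move=> hu [Xs Xp]; split=> [|v v0].
  by rewrite !trmx_mul trmxK Xs mulmxA.
have -> : v^T *m (h *m X *m h^T) *m v = (h^T *m v)^T *m X *m (h^T *m v).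
  by rewrite trmx_mul trmxK !mulmxA.
apply: Xp; apply: contra v0 => /eqP w0; apply/eqP.
by rewrite -[v](@mulKmx _ _ _ h^T) ?unitmx_tr// w0 mulmx0.
Qed.

(** Induction on the size: the Schur complement B - a^-1 u u^T of the corner entry a is again
    positive definite, and its factor is completed by the column (sqrt a, u / sqrt a). *)
Lemma cholesky n (X : 'M[R]_n) : posdef X ->
  exists L : 'M[R]_n, [/\ L \in unitmx, is_trig_mx L & X = L *m L^T].
Proof.
elim: n X => [X _|n IH].
  by exists 1%:M; split; [exact: unitmx1|exact: scalar_mx_is_trig|rewrite !flatmx0].
change n.+1 with (1 + n)%N => X [Xs Xp].
pose a := X 0 0; pose u : 'cV_n := dlsubmx X; pose B := drsubmx X.
have Xul : ulsubmx X = a%:M.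
  apply/matrixP => i j; rewrite !ord1 !mxE /= mulr1n.
  by congr (X _ _); apply/val_inj.
have Xur : ursubmx X = u^T by rewrite /u -{1}Xs -trmx_dlsub.
have XE : X = block_mx a%:M u^T u B by rewrite -Xul -Xur submxK.
have Bs : B^T = B by rewrite /B trmx_drsub Xs.
have a0 : 0 < a.
  have := Xp (delta_mx 0 0); rewrite -colE.
  rewrite trmx_delta -rowE !mxE; apply.
  by apply/eqP => /matrixP/(_ 0 0)/eqP; rewrite !mxE/= oner_eq0.
have aN0 : a != 0 by rewrite gt_eqF.
have [L [Lu Lt LE]] : exists L : 'M[R]_n,
    [/\ L \in unitmx, is_trig_mx L & B - a^-1 *: (u *m u^T) = L *m L^T].
  apply: IH; split.
    by rewrite linearB/= linearZ/= trmx_mul trmxK Bs.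
  (* For fixed lower coordinates v, [T *m v] minimizes the form of X; hence T^T X T is the Schur
     complement. *)
  move=> v v0; pose T : 'M[R]_(1 + n, n) := col_mx (- a^-1 *: u^T) 1%:M.
  have -> : B - a^-1 *: (u *m u^T) = T^T *m X *m T.
    have -> : T^T = row_mx (- a^-1 *: u) 1%:M.
      by rewrite tr_col_mx trmx1 [X in row_mx X _]linearZ/= trmxK.
    rewrite XE mul_row_block mul_row_col !mul1mx mulmx1.
    rewrite mul_mx_scalar scalerA mulrN mulfV// scaleN1r.
    by rewrite addNr mul0mx add0r -scalemxAl scaleNr addrC.
  rewrite -!mulmxA mulmxA -trmx_mul mulmxA; apply: Xp.
  by rewrite mul_col_mx mul1mx col_mx_eq0 negb_and v0 orbT.
exists (block_mx (Num.sqrt a)%:M 0 ((Num.sqrt a)^-1 *: u) L).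
have sa0 : Num.sqrt a != 0 by rewrite sqrtr_eq0 -ltNge.
have sa2 : Num.sqrt a * Num.sqrt a = a by rewrite -expr2 sqr_sqrtr ?ltW.
split.
- rewrite unitmxE det_lblock det_scalar expr1 unitrM unitfE sa0/=.
  by rewrite -unitmxE.
- by rewrite is_trig_block_mx// eqxx Lt scalar_mx_is_trig.
- rewrite tr_block_mx mulmx_block !trmx0 tr_scalar_mx linearZ/=.
  rewrite !mulmx0 !mul0mx !addr0 -scalar_mxM sa2 mul_scalar_mx scalerA mulfV//.
  rewrite scale1r mul_mx_scalar scalerA mulfV// scale1r -LE.
  rewrite -scalemxAl -scalemxAr scalerA -invfM sa2.
  by rewrite XE addrC subrK.
Qed.

(** With b the Cholesky factor of g^T g, the matrix k = g b^-T satisfies k^T k = b^-1 (b b^T) b^-T =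
    1. *)
Lemma qr_decomposition n (g : 'M[R]_n) : g \in unitmx ->
  exists k b : 'M[R]_n,
    [/\ k^T *m k = 1%:M, b \in unitmx, is_trig_mx b & g = k *m b^T].
Proof.
move=> gu; have gTu : g^T \in unitmx by rewrite unitmx_tr.
have := posdef_gram gTu; rewrite trmxK => /cholesky[b [bu bt gb]].
have bTu : b^T \in unitmx by rewrite unitmx_tr.
exists (g *m invmx b^T), b; split=> //; last by rewrite mulmxKV.
rewrite trmx_mul -mulmxA (mulmxA g^T) gb trmx_inv trmxK.
by rewrite !mulmxA mulVmx// mul1mx mulmxV.
Qed.

End CholeskyQR.

(** * Limit flags as sublevel sets of the growth exponent *)

Section Flags.
Variables (R : realType) (n : nat).
Implicit Types (g h : 'M[R]_n) (phi : 'rV[R]_n) (v : 'cV[R]_n).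

(** The 0/1 diagonal masks the coordinates outside P, so a condition on coordinates becomes a kernel
    and thus a [{vspace _}], as [flag] requires. *)
Definition coordsp g (P : pred 'I_n) : {vspace 'cV[R]_n} :=
  lker (linfun (mulmx (diag_mx (\row_j (P j)%:R) *m g^T))).

Lemma coordspP g (P : pred 'I_n) v :
  v \in coordsp g P <-> forall j, P j -> (g^T *m v) j 0 = 0.
Proof.
rewrite memv_ker lfunE/= -mulmxA mul_diag_mx; split.
  by move=> /eqP/matrixP v0 j Pj; have := v0 j 0; rewrite !mxE Pj mul1r.
move=> v0; apply/eqP/matrixP => i j; rewrite ord1 !mxE.
case: (boolP (P i)) => [Pi|_]; last by rewrite mul0r.
by have := v0 i Pi; rewrite mxE => ->; rewrite mulr0.
Qed.

Lemma eq_coordsp g (P Q : pred 'I_n) : P =1 Q -> coordsp g P = coordsp g Q.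
Proof.
move=> PQ; apply/vspaceP => v; apply/idP/idP => /coordspP Pv; apply/coordspP => j.
  by rewrite -PQ; exact: Pv.
by rewrite PQ; exact: Pv.
Qed.

Lemma coordsp0 g (P : pred 'I_n) : g \in unitmx -> (forall j, P j) ->
  coordsp g P = 0%VS.
Proof.
move=> gu PT; apply/vspaceP => v; rewrite memv0; apply/idP/eqP; last first.
  by move=> ->; rewrite mem0v.
move=> /coordspP Pv; rewrite -[v](@mulKmx _ _ _ g^T) ?unitmx_tr//.
suff -> : g^T *m v = 0 by rewrite mulmx0.
by apply/matrixP => i j; rewrite ord1 Pv// mxE.
Qed.

Lemma coordspT g (P : pred 'I_n) : (forall j, ~~ P j) -> coordsp g P = fullv.
Proof.
move=> PF; apply/vspaceP => v; rewrite memvf; apply/coordspP => j.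
by rewrite (negbTE (PF j)).
Qed.

(** The basis dual to the columns of g; its members test which coordinates a subspace constrains.
    For orthonormal k it consists of the columns of k. *)
Definition dualv g (j : 'I_n) : 'cV[R]_n := col j (invmx g^T).

Lemma mul_dualv g i j : g \in unitmx -> (g^T *m dualv g j) i 0 = (i == j)%:R.
Proof.
by move=> gu; rewrite /dualv colE mulmxA mulmxV ?unitmx_tr// mul1mx mxE andbT.
Qed.

Lemma mem_dualv g (P : pred 'I_n) j : g \in unitmx ->
  (dualv g j \in coordsp g P) = ~~ P j.
Proof.
move=> gu; apply/idP/idP.
  move=> /coordspP/(_ j); rewrite mul_dualv// eqxx => Pj; apply/negP => /Pj.
  by move/eqP; rewrite oner_eq0.
move=> Pj; apply/coordspP => i Pi; rewrite mul_dualv//.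
by case: eqP => // ij; move: Pj; rewrite -ij Pi.
Qed.

Lemma dualv_neq0 g j : g \in unitmx -> dualv g j != 0.
Proof.
move=> gu; apply/eqP => /(congr1 (fun v => (g^T *m v) j 0)).
by rewrite mul_dualv// eqxx mulmx0 mxE => /eqP; rewrite oner_eq0.
Qed.

(* {v | lam(v) <= c} *)
Definition lowsp g phi (c : R) := coordsp g (fun j => c < phi 0 j).

Definition tailsp g (d : nat) := coordsp g (fun j : 'I_n => (j < d)%N).

(** The coordinates with exponent above psi_(k+1) are the first i_k, so W_k is the sublevel set at
    psi_(k+1); for k = m there is no such exponent, hence the appended 0. *)
Definition flagseq g phi : seq {vspace 'cV[R]_n} :=
  rcons [seq lowsp g phi c | c <- distinct_exponents phi] 0%VS.

Lemma mem_distinct_exponents phi c :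
  c \in distinct_exponents phi <-> exists j, phi 0 j = c.
Proof.
rewrite mem_undup; split=> [/mapP[j _ ->]|[j <-]]; first by exists j.
by apply: map_f; rewrite mem_enum.
Qed.

Lemma distinct_exponents_sorted phi : nonincreasing_row phi ->
  sorted >%O (distinct_exponents phi).
Proof.
move=> ninc; rewrite sorted_pairwise; last exact: (rev_trans lt_trans).
have s_ge : sorted >=%O (exponents phi).
  rewrite sorted_map.
  have : sorted (fun i j : 'I_n => (i <= j)%N) (enum 'I_n).
    have := iota_sorted 0 n; rewrite -val_enum_ord sorted_map.
    by apply: sub_sorted.
  by apply: sub_sorted => i j /ninc.
have {s_ge} : sorted >=%O (distinct_exponents phi).
  exact: (subseq_sorted ge_trans (undup_subseq _)).
rewrite sorted_pairwise; last exact: ge_trans.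
have : uniq (distinct_exponents phi) by rewrite undup_uniq.
elim: (distinct_exponents phi) => //= x s IH /andP[xs /IH{}IH] /andP[/allP sx /IH->].
rewrite andbT; apply/allP => y ys; have := sx y ys; rewrite /= le_eqVlt.
by case: eqP ys => // -> ys; rewrite ys in xs.
Qed.

Lemma card_ord_lt m : (m <= n)%N -> #|[set i : 'I_n | (i < m)%N]%SET| = m.
Proof.
move=> mn; rewrite -sum1_card (eq_bigl (fun i : 'I_n => (i < m)%N)).
  by rewrite -(big_ord_widen n (fun=> 1%N))// sum1_card card_ord.
by move=> i; rewrite /= inE.
Qed.

Lemma mem_downset (D : {set 'I_n}) :
  (forall i j : 'I_n, (i <= j)%N -> j \in D -> i \in D) ->
  forall j, (j \in D) = (j < #|D|)%N.
Proof.
move=> Ddown j; apply/idP/idP => [jD|].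
  rewrite -(card_ord_lt (ltn_ord j)) subset_leq_card//.
  by apply/fintype.subsetP => i; rewrite inE ltnS => /Ddown; exact.
apply: contraLR => jD; rewrite -leqNgt -[leqRHS](card_ord_lt (ltnW (ltn_ord j))).
rewrite subset_leq_card//; apply/fintype.subsetP => i iD; rewrite inE ltnNge.
by apply: contra jD => ji; apply: Ddown ji iD.
Qed.

Lemma downset_ord (P : pred 'I_n) :
  (forall i j : 'I_n, (i <= j)%N -> P j -> P i) ->
  exists2 d, (d <= n)%N & forall j : 'I_n, P j = (j < d)%N.
Proof.
move=> Pd; exists #|[set j | P j]%SET|; first by rewrite -[leqRHS]card_ord max_card.
by move=> j; rewrite -mem_downset ?inE// => i i'; rewrite !inE => /Pd; exact.
Qed.

Lemma nth_distinct_lt phi k j : nonincreasing_row phi ->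
  (k < size (distinct_exponents phi))%N ->
  (index (phi 0%R j) (distinct_exponents phi) < k)%N =
  (nth 0 (distinct_exponents phi) k < phi 0 j).
Proof.
move=> ninc km; set s := distinct_exponents phi.
have ss : sorted >%O s by exact: distinct_exponents_sorted.
have js : phi 0 j \in s by apply/mem_distinct_exponents; exists j.
have lt_nth := sorted_ltn_nth (rev_trans lt_trans) 0 ss.
rewrite -[in RHS](nth_index 0 js); apply/idP/idP => [jk|].
  by apply: lt_nth; rewrite ?inE ?index_mem.
apply: contraTT; rewrite -leqNgt -leNgt leq_eqVlt => /predU1P[->//|kj].
by apply/ltW/lt_nth; rewrite ?inE ?index_mem.
Qed.

Lemma sum_count_mem (T : eqType) (s t : seq T) : uniq s ->
  (\sum_(x <- s) count_mem x t = count [in s] t)%N.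
Proof.
elim: s => [_|x s IH /andP[xs us]].
  by rewrite big_nil; elim: t.
rewrite big_cons IH//; elim: t {IH} => //= y t <-.
rewrite addnACA in_cons; congr addn.
by case: eqP => // ->; rewrite (negbTE xs).
Qed.

(** The coordinates carrying one of the k largest exponents form an initial segment of ['I_n], which
    is determined by its cardinality i_k. *)
Lemma cumul_multP phi k (j : 'I_n) : nonincreasing_row phi ->
  (j < cumul_mult phi k)%N =
  (index (phi 0%R j) (distinct_exponents phi) < k)%N.
Proof.
move=> ninc; set s := distinct_exponents phi.
have ss : sorted >%O s by exact: distinct_exponents_sorted.
have js i : phi 0 i \in s by apply/mem_distinct_exponents; exists i.
pose D := [set i | (index (phi 0%R i) s < k)%N]%SET.
have -> : cumul_mult phi k = #|D|.
  have us : uniq (take k s) by rewrite take_uniq// undup_uniq.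
  rewrite /cumul_mult -/s sum_count_mem// /exponents count_map.
  rewrite -sum1_count big_enum_cond/= -sum1_card; apply: eq_bigl => i.
  by rewrite /= inE in_take.
rewrite -mem_downset ?inE// => i i' ii'; rewrite !inE; apply: leq_ltn_trans.
rewrite leqNgt nth_distinct_lt ?index_mem//.
by rewrite nth_index// -leNgt ninc.
Qed.

(** Eliminates the multiplicities: afterwards a limit flag is handled only as a list of sublevel
    sets. *)
Lemma limit_flag_repE g phi W : g \in unitmx -> nonincreasing_row phi ->
  limit_flag_rep g phi W <-> W = flagseq g phi.
Proof.
move=> gu ninc; set s := distinct_exponents phi.
have js i : (index (phi 0%R i) s < size s)%N.
  by rewrite index_mem; apply/mem_distinct_exponents; exists i.
have sE : size (flagseq g phi) = (size s).+1 by rewrite size_rcons size_map.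
have nE k v : (k <= size s)%N -> v \in nth 0%VS (flagseq g phi) k <->
    forall j : 'I_n, (j < cumul_mult phi k)%N -> (g^T *m v) j 0 = 0.
  rewrite leq_eqVlt => /predU1P[->|ks]; rewrite nth_rcons size_map.
    rewrite ltnn eqxx -(@coordsp0 g (fun j => (index (phi 0%R j) s < size s)%N))//.
    split=> [/coordspP H j _|H]; first exact: H.
    by apply/coordspP => j _; apply: H; rewrite cumul_multP.
  rewrite ks (nth_map 0)//.
  split=> [/coordspP H j|H].
    by rewrite cumul_multP// nth_distinct_lt//; exact: H.
  apply/coordspP => j jk; apply: H.
  by rewrite cumul_multP// nth_distinct_lt.
split=> [[Ws WE]|->]; last first.
  by split=> // k; rewrite sE ltnS => ks v; exact: nE.
apply: (@eq_from_nth _ 0%VS); first by rewrite sE.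
move=> k kW; have ks : (k <= size s)%N by rewrite -ltnS -Ws.
apply/vspaceP => v; apply/idP/idP => H.
  by apply/(nE k v ks); apply/(WE k kW).
by apply/(WE k kW); apply/(nE k v ks).
Qed.

Lemma mem_flagseq g phi U : (0 < n)%N -> g \in unitmx ->
  U \in flagseq g phi <-> exists c, U = lowsp g phi c.
Proof.
move=> n0 gu; rewrite mem_rcons inE; split.
  move=> /predU1P[->|/mapP[c _ ->]]; last by exists c.
  (* This is one less than the minimum of 0 and all exponents, so it lies strictly below every
     exponent. *)
  exists (\big[Num.min/0]_j phi 0 j - 1); rewrite /lowsp coordsp0// => j.
  by rewrite ltrBlDr ltr_pwDr// bigmin_le_cond.
move=> [c ->].
have [/existsP[i0 i0c]|/existsPn cphi] := boolP [exists i, phi 0 i <= c].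
  apply/orP; right; apply/mapP.
  (* The largest exponent not exceeding c has the same sublevel set as c. *)
  case: (@arg_maxP _ _ _ i0 (fun i => phi 0 i <= c) (fun i => phi 0 i) i0c).
  move=> i ic imax; exists (phi 0 i).
    by apply/mem_distinct_exponents; exists i.
  apply: eq_coordsp => j; apply/idP/idP; first exact: le_lt_trans.
  by apply: contraLR; rewrite -!leNgt; exact: imax.
by rewrite /lowsp coordsp0 ?eqxx// => j; rewrite ltNge cphi.
Qed.

Definition strict_sub (U V : {vspace 'cV[R]_n}) := (V <= U)%VS && (V != U).

Lemma strict_sub_trans : transitive strict_sub.
Proof.
move=> V U W /andP[VU VU'] /andP[WV WV']; rewrite /strict_sub.
rewrite (subv_trans WV VU); apply: contra VU' => /eqP WU.
by rewrite eqEsubv VU -WU WV.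
Qed.

Lemma strict_sub_irr : irreflexive strict_sub.
Proof. by move=> U; rewrite /strict_sub eqxx andbF. Qed.

Lemma lowsp_sub g phi c c' : c <= c' -> (lowsp g phi c <= lowsp g phi c')%VS.
Proof.
move=> cc'; apply/subvP => v /coordspP H; apply/coordspP => j c'j.
by apply: H; exact: le_lt_trans c'j.
Qed.

Lemma flagseq_sorted g phi : g \in unitmx -> nonincreasing_row phi ->
  sorted strict_sub (flagseq g phi).
Proof.
move=> gu ninc; have [n0|n0] := posnP n.
  rewrite /flagseq /distinct_exponents /exponents.
  have -> : enum 'I_n = [::] by apply/nilP; rewrite /nilp size_enum_ord n0.
  by [].
have strict c c' : (exists j, phi 0 j = c') -> c < c' ->
    strict_sub (lowsp g phi c') (lowsp g phi c).
  move=> [j jc'] cc'; rewrite /strict_sub lowsp_sub ?ltW//=.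
  apply/eqP => /vspaceP/(_ (dualv g j)).
  by rewrite !mem_dualv// jc' cc' ltxx.
(* A sentinel below all exponents makes the final 0 a sublevel set too, so strictness is checked
   along a single strictly decreasing list. *)
have [s' ss'] : exists s', s' = rcons (distinct_exponents phi)
    (\big[Num.min/0]_j phi 0 j - 1) by eexists.
have -> : flagseq g phi = map (lowsp g phi) s'.
  rewrite ss' map_rcons; congr rcons; rewrite /lowsp coordsp0// => j.
  by rewrite ltrBlDr ltr_pwDr// bigmin_le_cond.
apply/(sortedP 0%VS) => i; rewrite size_map ss' size_rcons ltnS => si.
have s'i : (i.+1 < size s')%N by rewrite ss' size_rcons ltnS.
rewrite -ss' !(nth_map 0) ?(ltnW s'i)//; apply: strict.
  by apply/mem_distinct_exponents; rewrite ss' nth_rcons si mem_nth.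
rewrite ss' !nth_rcons si; have [i1|i1] := ltnP i.+1 (size (distinct_exponents phi)).
  by have /(sortedP 0)/(_ i i1) := distinct_exponents_sorted ninc.
rewrite (_ : i.+1 == size _); last by rewrite eqn_leq si.
have /mem_distinct_exponents[j <-] := mem_nth 0 si.
by rewrite ltrBlDr ltr_pwDr// bigmin_le_cond.
Qed.

(** A strictly sorted sequence is determined by its members, and multiplication of c by a only
    relabels the sublevel sets. *)
Lemma eq_flagseq g phi h phi' (a : R) : (0 < n)%N ->
  g \in unitmx -> nonincreasing_row phi ->
  h \in unitmx -> nonincreasing_row phi' -> 0 < a ->
  (forall c, lowsp h phi' (a * c) = lowsp g phi c) ->
  flagseq h phi' = flagseq g phi.
Proof.
move=> n0 gu ninc hu ninc' a0 E.
apply: (irr_sorted_eq strict_sub_trans strict_sub_irr); try exact: flagseq_sorted.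
move=> U; apply/idP/idP => /mem_flagseq -/(_ n0).
  move=> /(_ hu)[c ->]; apply/mem_flagseq => //; exists (c / a).
  by rewrite -E mulrCA mulfV ?mulr1// gt_eqF.
by move=> /(_ gu)[c ->]; apply/mem_flagseq => //; exists (a * c).
Qed.

End Flags.

(** * Orthonormal bases adapted to a flag *)

Section AdaptedBasis.
Variables (R : realType) (n : nat).
Implicit Types (g h k : 'M[R]_n) (phi : 'rV[R]_n) (v : 'cV[R]_n).

(** Forward substitution: row j of b involves only coordinates up to j, and its diagonal coefficient
    is nonzero. *)
Lemma trig_mx_prefix0 (b : 'M[R]_n) (y : 'cV[R]_n) d :
  b \in unitmx -> is_trig_mx b ->
  (forall j : 'I_n, (j < d)%N -> (b *m y) j 0 = 0) <->
  (forall j : 'I_n, (j < d)%N -> y j 0 = 0).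
Proof.
move=> bu bt; have bii i : b i i != 0.
  move: bu; rewrite unitmxE det_trig// unitfE => /prodf_neq0; exact.
have /is_trig_mxP bt0 := bt; split=> by0 j jd; last first.
  rewrite mxE big1// => i _; have [ij|/bt0->] := leqP i j; last by rewrite mul0r.
  by rewrite by0 ?mulr0// (leq_ltn_trans ij).
have [m] := ubnP j; elim: m => // m IH in j jd *; rewrite ltnS => jm.
have := by0 j jd; rewrite mxE (bigD1 j)//= big1 ?addr0.
  by move=> /eqP; rewrite mulf_eq0 (negbTE (bii j)) => /eqP.
move=> i ij; have [lij|/bt0->] := leqP i j; last by rewrite mul0r.
have {}lij : (i < j)%N by rewrite ltn_neqAle ij.
by rewrite IH ?mulr0// (leq_trans lij)// ltnW.
Qed.

Lemma tailsp_qr k (b : 'M[R]_n) d : b \in unitmx -> is_trig_mx b ->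
  tailsp (k *m b^T) d = tailsp k d.
Proof.
move=> bu bt; apply/vspaceP => v; have E := trig_mx_prefix0 (k^T *m v) d bu bt.
have kbE : (k *m b^T)^T *m v = b *m (k^T *m v) by rewrite trmx_mul trmxK mulmxA.
apply/idP/idP => /coordspP H; apply/coordspP; move: H; rewrite kbE => H;
  exact/E.
Qed.

(** Built from the small end: a basis of a complement of V in U is put in front of the basis of V,
    so suffixes obtained earlier remain suffixes. *)
Lemma chain_basis (U : {vspace 'cV[R]_n}) s : path (@strict_sub R n) U s ->
  last U s = 0%VS ->
  exists2 b : seq 'cV[R]_n, basis_of U b &
    forall V, V \in U :: s -> exists2 d, (d <= size b)%N & V = <<drop d b>>%VS.
Proof.
elim: s U => [U _ /= ->|V s IH U /= /andP[/andP[VU _] Vs] sl].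
  exists [::]; first by rewrite nil_basis.
  by move=> V; rewrite inE => /eqP ->; exists 0%N => //=; rewrite span_nil.
have [b bV bs] := IH _ Vs sl.
have Ub : basis_of U (vbasis (U :\: V) ++ b).
  have UV : (U :\: V + V)%VS = U by rewrite addv_diff; exact/addv_idPl.
  rewrite -[X in basis_of X _]UV.
  apply: cat_basis; [|exact: vbasisP|exact: bV].
  by apply/directv_addP; rewrite capv_diff.
exists (vbasis (U :\: V) ++ b) => // X; rewrite inE => /predU1P[->|/bs[d db ->]].
  by exists 0%N => //; rewrite drop0 (span_basis Ub).
exists (size (vbasis (U :\: V)) + d)%N; first by rewrite size_cat leq_add2l.
by rewrite drop_cat ltnNge leq_addr /= addKn.
Qed.

Lemma flag_basis W : flag W ->
  exists2 g : 'M[R]_n, g \in unitmx &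
    forall U, U \in W -> exists2 d, (d <= n)%N & U = tailsp g d.
Proof.
case: W => [|U s] [//= _ Uf sl Us].
have [b Ub bs] := chain_basis Us sl.
have sb : size b = n.
  have /andP[/eqP bU /eqP <-] := Ub.
  by rewrite bU Uf dimvf /dim/= muln1.
pose B := \matrix_(i, j < n) (nth 0 b j) i 0.
have Bmul (y : 'cV[R]_n) : B *m y = \sum_(j < n) y j 0 *: nth 0 b j.
  apply/matrixP => i l; rewrite ord1 mxE summxE; apply: eq_bigr => j _.
  by rewrite !mxE mulrC.
have BTu : B^T \in unitmx.
  rewrite -row_free_unit; apply: inj_row_free => y.
  move=> /(congr1 trmx); rewrite trmx_mul trmxK trmx0 Bmul => y0.
  have := basis_free Ub; move: y0; rewrite -[b]in_tupleE.
  move: (in_tuple b); rewrite sb => t y0 /freeP/(_ _ y0) {}y0.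
  by apply/matrixP => i j; rewrite ord1 mxE; have := y0 j; rewrite !mxE.
have Bu : B \in unitmx by rewrite -unitmx_tr.
(* B has the columns b, so for g = B^-T the vector g^T v lists the coordinates of v in b; dropping d
   basis vectors means that the first d coordinates vanish. *)
exists (invmx B^T); first by rewrite unitmx_inv.
move=> V /bs[d db ->]; exists d; first by rewrite -sb.
rewrite /tailsp; set C := coordsp _ _.
have memC v : v \in C <-> forall j : 'I_n, (j < d)%N -> (invmx B *m v) j 0 = 0.
  have -> : invmx B = (invmx B^T)^T by rewrite trmx_inv trmxK.
  exact: coordspP.
apply/eqP; rewrite eqEsubv; apply/andP; split.
  apply/span_subvP => v /(nthP 0)[i]; rewrite size_drop nth_drop => id <-.
  apply/memC => j jd.
  have idn : (d + i < n)%N by rewrite -sb -ltn_subRL.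
  have -> : nth 0 b (d + i) = B *m delta_mx (Ordinal idn) 0.
    by rewrite -colE; apply/matrixP => x y; rewrite ord1 !mxE.
  rewrite mulKmx// mxE; case: eqP => // ji; move: jd.
  by rewrite ji /= ltnNge leq_addr.
apply/subvP => v /memC v0; rewrite -[v](mulKVmx Bu) Bmul.
apply: memv_suml => j _; have [jd|dj] := ltnP j d.
  by rewrite v0// scale0r mem0v.
rewrite memvZ// memv_span//; apply/(nthP 0); exists (j - d)%N.
  by rewrite size_drop ltn_sub2r// ?sb ?(leq_ltn_trans dj).
by rewrite nth_drop subnKC.
Qed.

Lemma flag_orthonormal_basis W : flag W ->
  exists2 k : 'M[R]_n, k^T *m k = 1%:M &
    forall U, U \in W -> exists2 d, (d <= n)%N & U = tailsp k d.
Proof.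
move=> /flag_basis[g gu gW]; have [k [b [kk bu bt gE]]] := qr_decomposition gu.
exists k => // U /gW[d dn ->]; exists d => //.
by rewrite gE tailsp_qr.
Qed.

Lemma orthonormal_unit k : k^T *m k = 1%:M -> k \in unitmx.
Proof. by move=> /mulmx1_unit[]. Qed.

Lemma orthonormal_tr k : k^T *m k = 1%:M -> k *m k^T = 1%:M.
Proof. exact: mulmx1C. Qed.

Lemma orthonormal_inv k : k^T *m k = 1%:M -> invmx k^T = k.
Proof.
move=> kk; have kTu : k^T \in unitmx by rewrite unitmx_tr orthonormal_unit.
by rewrite -[LHS]mulmx1 -kk mulKmx.
Qed.

(** Provides lam(v) as the exponent of an actual coordinate i. *)
Lemma dominant_coord g phi v : g \in unitmx -> v != 0 ->
  exists2 i, (g^T *m v) i 0 != 0 &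
    forall j, (g^T *m v) j 0 != 0 -> phi 0 j <= phi 0 i.
Proof.
move=> gu v0; have [i0 i0P] : exists i, (g^T *m v) i 0 != 0.
  apply/existsP; apply: contraR v0; rewrite negb_exists => /forallP w0.
  rewrite -memv0 -(@coordsp0 _ _ g predT)//; apply/coordspP => j _; apply/eqP.
  by have := w0 j; rewrite negbK.
case: (@arg_maxP _ _ _ i0 (fun i => (g^T *m v) i 0 != 0) (fun i => phi 0 i) i0P).
by move=> i ic imax; exists i.
Qed.

Lemma mem_lowsp g phi v i c : (g^T *m v) i 0 != 0 ->
  (forall j, (g^T *m v) j 0 != 0 -> phi 0 j <= phi 0 i) ->
  (v \in lowsp g phi c) = (phi 0 i <= c).
Proof.
move=> vi imax; apply/idP/idP.
  move=> /coordspP H; rewrite leNgt; apply: contra vi => /H ->//.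
move=> ic; apply/coordspP => j cj; apply/eqP; apply/negPn/negP => /imax.
by rewrite leNgt (le_lt_trans ic cj).
Qed.

(** The new j-th exponent is the growth exponent of [dualv k j]. It is nonincreasing in j because
    every sublevel set is a tail with respect to k. *)
Lemma adapted_exponents g phi k : g \in unitmx -> k \in unitmx ->
  (forall c, exists d, lowsp g phi c = tailsp k d) ->
  exists2 phi', nonincreasing_row phi' &
    forall c, lowsp k phi' c = lowsp g phi c.
Proof.
move=> gu ku gk.
have /choice[f fE] : forall j, exists r, forall c,
    (dualv k j \in lowsp g phi c) = (r <= c).
  move=> j; have [i vi imax] := dominant_coord phi gu (dualv_neq0 j ku).
  by exists (phi 0 i) => c; exact: mem_lowsp.
have fd c d j : lowsp g phi c = tailsp k d -> (c < f j) = (j < d)%N.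
  by move=> cd; rewrite ltNge -fE cd mem_dualv// negbK.
exists (\row_j f j).
  move=> i j ij; rewrite !mxE leNgt; apply/negP.
  have [d cd] := gk (f i) => fij.
  have := ltxx (f i); rewrite (fd _ _ _ cd) => /negP; apply.
  by apply: leq_ltn_trans ij _; rewrite -(fd _ _ _ cd).
move=> c; have [d cd] := gk c; rewrite cd; apply: eq_coordsp => j.
by rewrite mxE; exact: fd.
Qed.

(** Functional calculus for the symmetric matrix k diag(phi) k^T, k orthonormal: f = id gives the
    velocity at E, and f(x) = e^(x t) the point of the geodesic at time t. *)
Definition spectral k phi (f : R -> R) : 'M[R]_n :=
  k *m diag_mx (\row_j f (phi 0 j)) *m k^T.

(** The transition matrix h^T k links only equal exponents, so it intertwines diag(f(phi)) and
    diag(f(phi')) for every f. *)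
Lemma spectral_eq k phi h phi' : k^T *m k = 1%:M -> h^T *m h = 1%:M ->
  (forall i j, (h^T *m k) i j != 0 -> phi 0 j = phi' 0 i) ->
  forall f, spectral k phi f = spectral h phi' f.
Proof.
move=> kk hh m0 f; rewrite /spectral.
have : (h^T *m k) *m diag_mx (\row_j f (phi 0 j)) =
    diag_mx (\row_j f (phi' 0 j)) *m (h^T *m k).
  rewrite mul_mx_diag mul_diag_mx; apply/matrixP => i j.
  rewrite [LHS]mxE [RHS]mxE [X in _ * X]mxE [X in _ = X * _]mxE [RHS]mulrC.
  by have [->|/m0->] := eqVneq ((h^T *m k) i j) 0; rewrite ?mul0r.
move=> /(congr1 (fun X => h *m X *m k^T)); rewrite -!mulmxA.
by rewrite (orthonormal_tr kk) mulmx1 mulmxA (orthonormal_tr hh) mul1mx => ->.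
Qed.

(** Column j of k lies in the sublevel set of its own exponent, so it is orthogonal to the columns
    of h with larger exponent; exchanging the roles gives the opposite inequality. *)
Lemma spectral_of_lowsp k phi h phi' : k^T *m k = 1%:M -> h^T *m h = 1%:M ->
  (forall c, lowsp k phi c = lowsp h phi' c) ->
  forall f, spectral k phi f = spectral h phi' f.
Proof.
move=> kk hh E; apply: spectral_eq => // i j mij.
have half k1 phi1 h1 phi2 i1 j1 : k1^T *m k1 = 1%:M ->
    (forall c, lowsp k1 phi1 c = lowsp h1 phi2 c) ->
    (h1^T *m k1) i1 j1 != 0 -> phi2 0 i1 <= phi1 0 j1.
  move=> kk1 E1; apply: contraR; rewrite -ltNge => lt12.
  have : dualv k1 j1 \in lowsp k1 phi1 (phi1 0 j1).
    by rewrite mem_dualv ?ltxx// orthonormal_unit.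
  rewrite E1 => /coordspP/(_ _ lt12); rewrite /dualv orthonormal_inv//.
  by rewrite colE mulmxA -colE mxE => ->.
apply/eqP; rewrite eq_le (half k phi h phi' i j)// andbT.
rewrite (half h phi' k phi j i)//.
have -> : k^T *m h = (h^T *m k)^T by rewrite trmx_mul trmxK.
by rewrite mxE.
Qed.

(** Equality for f = id says (h^T k)_ij phi_j = phi'_i (h^T k)_ij. Thus the velocity at E determines
    the whole geodesic. *)
Lemma spectral_of_id k phi h phi' : k^T *m k = 1%:M -> h^T *m h = 1%:M ->
  spectral k phi id = spectral h phi' id ->
  forall f, spectral k phi f = spectral h phi' f.
Proof.
move=> kk hh E; apply: spectral_eq => // i j mij.
have : (h^T *m k) *m diag_mx (\row_j phi 0 j) =
    diag_mx (\row_j phi' 0 j) *m (h^T *m k).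
  move: E; rewrite /spectral => /(congr1 (fun X => h^T *m X *m k)).
  by rewrite -!mulmxA kk mulmx1 !mulmxA hh mul1mx.
move=> /matrixP/(_ i j); rewrite mul_mx_diag mul_diag_mx.
rewrite [LHS]mxE [RHS]mxE [X in _ * X]mxE [X in _ = X * _]mxE [RHS]mulrC.
exact: mulfI.
Qed.

End AdaptedBasis.

(** * Limits of matrices *)

Section MatrixLimits.
Variables (R : realType) (T : Type) (F : set_system T).
Context {FF : Filter F}.

Lemma cvg_mxP m n (A : T -> 'M[R]_(m, n)) (B : 'M[R]_(m, n)) :
  (A x @[x --> F] --> B) <-> (forall i j, A x i j @[x --> F] --> B i j).
Proof.
split=> [AB i j|AB].
  exact: (cvg_comp _ _ AB (@coord_continuous _ _ _ i j B)).
move=> /= U [P BP PU].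
have : \forall x \near F, forall i j, P i j (A x i j).
  by apply: filter_forall => i; apply: filter_forall => j; exact: AB.
by apply: filterS => x Px; apply: PU => i j; exact: Px.
Qed.

Lemma cvg_sumr (I : Type) (r : seq I) (P : pred I) (f : I -> T -> R) (l : I -> R) :
  (forall i, P i -> f i x @[x --> F] --> l i) ->
  \sum_(i <- r | P i) f i x @[x --> F] --> \sum_(i <- r | P i) l i.
Proof. by apply: cvg_big; exact: add_continuous. Qed.

Lemma cvg_prodr (I : Type) (r : seq I) (P : pred I) (f : I -> T -> R) (l : I -> R) :
  (forall i, P i -> f i x @[x --> F] --> l i) ->
  \prod_(i <- r | P i) f i x @[x --> F] --> \prod_(i <- r | P i) l i.
Proof. by apply: cvg_big; exact: mul_continuous. Qed.

Lemma cvg_mulmx m n p (A : T -> 'M[R]_(m, n)) (B : T -> 'M[R]_(n, p))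
    (A0 : 'M[R]_(m, n)) (B0 : 'M[R]_(n, p)) :
  A x @[x --> F] --> A0 -> B x @[x --> F] --> B0 ->
  A x *m B x @[x --> F] --> A0 *m B0.
Proof.
move=> /cvg_mxP AA /cvg_mxP BB; apply/cvg_mxP => i j; rewrite mxE.
under eq_cvg do rewrite mxE.
by apply: cvg_sumr => k _; apply: cvgM.
Qed.

Lemma cvg_mxtrace n (A : T -> 'M[R]_n) (A0 : 'M[R]_n) :
  A x @[x --> F] --> A0 -> \tr (A x) @[x --> F] --> \tr A0.
Proof. by move=> /cvg_mxP AA; apply: cvg_sumr => i _. Qed.

Lemma cvg_determinant n (A : T -> 'M[R]_n) (A0 : 'M[R]_n) :
  A x @[x --> F] --> A0 -> \det (A x) @[x --> F] --> \det A0.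
Proof.
move=> /cvg_mxP AA; apply: cvg_sumr => s _; apply: cvgM; first exact: cvg_cst.
by apply: cvg_prodr.
Qed.

Lemma cvg_invmx n (A : T -> 'M[R]_n) (A0 : 'M[R]_n) : A0 \in unitmx ->
  A x @[x --> F] --> A0 -> invmx (A x) @[x --> F] --> invmx A0.
Proof.
move=> A0u AA; have dA := cvg_determinant AA.
have d0 : \det A0 != 0 by rewrite -unitfE -unitmxE.
have -> : invmx A0 = (\det A0)^-1 *: \adj A0 by rewrite /invmx A0u.
have nearA : \forall x \near F, (\det (A x))^-1 *: \adj (A x) = invmx (A x).
  have : \forall x \near F, \det (A x) != 0 by exact: cvgr_neq0 dA d0.
  by apply: filterS => x dx; rewrite /invmx unitmxE unitfE dx.
apply: cvg_trans.
  exact: (near_eq_cvg nearA).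
apply/cvg_mxP => i j; rewrite !mxE; under eq_cvg do rewrite !mxE.
apply: cvgM; first exact: cvgV.
apply: cvgM; first exact: cvg_cst.
apply: cvg_determinant; apply/cvg_mxP => i' j'.
rewrite !mxE; under eq_cvg do rewrite !mxE.
by move/cvg_mxP: AA; apply.
Qed.

End MatrixLimits.

(** * The metric against quadratic forms *)

Section Speed.
Variables (R : realType) (n : nat).

Definition qform (v : 'cV[R]_n) (X : 'M[R]_n) : R := (v^T *m X *m v) 0 0.

Definition sqspeed (X H : 'M[R]_n) : R := \tr (H *m invmx X *m H *m invmx X).

Lemma qform_congr v (h X : 'M[R]_n) :
  qform v (h *m X *m h^T) = qform (h^T *m v) X.
Proof. by rewrite /qform trmx_mul trmxK !mulmxA. Qed.

Lemma trace_gram_ge0 m (A : 'M[R]_(n, m)) : 0 <= \tr (A *m A^T).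
Proof.
apply: sumr_ge0 => i _; rewrite mxE; apply: sumr_ge0 => j _.
by rewrite mxE -expr2 sqr_ge0.
Qed.

Lemma trace_colr (A : 'M[R]_n) (v : 'cV[R]_n) :
  \tr (A *m v *m v^T) = qform v A.
Proof. by rewrite mxtrace_mulC mulmxA /qform /mxtrace big_ord1. Qed.

(* Cauchy-Schwarz for <S, w w^T>, from the expansion of |q^2 S - s w w^T|^2. *)
Lemma qform_sqr_le (S : 'M[R]_n) (w : 'cV[R]_n) : S^T = S ->
  qform w S ^+ 2 <= qform w 1%:M ^+ 2 * \tr (S *m S).
Proof.
move=> Ss; set q := qform w 1%:M; set s := qform w S.
have wwq : w^T *m w = q%:M by rewrite [LHS]mx11_scalar /q /qform mulmx1.
have [q0|q0] := eqVneq q 0.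
  have w0 : w = 0.
    apply/matrixP => i j; rewrite ord1 [RHS]mxE; apply/eqP.
    move: q0; rewrite /q /qform mulmx1 mxE => /eqP.
    rewrite psumr_eq0 => [/allP/(_ i)|k _]; last by rewrite mxE -expr2 sqr_ge0.
    by rewrite mem_index_enum mxE mulf_eq0 orbb => /(_ isT).
  by rewrite /s /qform w0 mulmx0 mxE expr0n/= mulr_ge0 ?sqr_ge0// -{2}Ss trace_gram_ge0.
have := trace_gram_ge0 (q ^+ 2 *: S - s *: (w *m w^T)).
set P := w *m w^T; set M := q ^+ 2 *: S - s *: P.
have -> : M^T = M.
  have Ps : P^T = P by rewrite trmx_mul trmxK.
  transitivity (q ^+ 2 *: S^T - s *: P^T); last by rewrite Ss Ps.
  by apply/matrixP => i j; rewrite !mxE.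
rewrite /M mulmxBl !mulmxBr -!scalemxAl -!scalemxAr !raddfB/= !mxtraceZ /P.
rewrite (_ : \tr (S *m (w *m w^T)) = s); last by rewrite mulmxA trace_colr.
rewrite (_ : \tr (w *m w^T *m S) = s); last by rewrite mxtrace_mulC mulmxA trace_colr.
rewrite (_ : \tr (w *m w^T *m (w *m w^T)) = q ^+ 2); last first.
  rewrite mulmxA -(mulmxA w) wwq mul_mx_scalar -scalemxAl linearZ/=.
  by rewrite mxtrace_mulC wwq mxtrace_scalar mulr1n expr2.
set t := \tr (S *m S) => H.
have q2 : 0 < q ^+ 2 by rewrite exprn_even_gt0.
rewrite -subr_ge0 -(pmulr_rge0 _ q2).
by move: H; congr (0 <= _); ring.
Qed.

Lemma sqspeed_congr (h X H : 'M[R]_n) : h \in unitmx -> X \in unitmx ->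
  sqspeed (h *m X *m h^T) (h *m H *m h^T) = sqspeed X H.
Proof.
move=> hu Xu; have hTu : h^T \in unitmx by rewrite unitmx_tr.
have E : h *m H *m h^T *m invmx (h *m X *m h^T) = h *m (H *m invmx X) *m invmx h.
  have -> : invmx (h *m X *m h^T) = invmx h^T *m invmx X *m invmx h.
    apply: (can_inj (mulKmx (_ : h *m X *m h^T \in unitmx))); last first.
      rewrite mulmxV ?unitmx_mul ?hu ?Xu ?hTu//.
      by rewrite !mulmxA mulmxK// mulmxK// mulmxV.
    by rewrite !unitmx_mul hu Xu.
  by rewrite !mulmxA mulmxK.
have sq Y K : sqspeed Y K = \tr ((K *m invmx Y) *m (K *m invmx Y)).
  by rewrite /sqspeed mulmxA.
rewrite !sq E; move: (H *m invmx X) => A.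
by rewrite -!mulmxA (mulKmx hu) mxtrace_mulC -!mulmxA mulVmx// mulmx1.
Qed.

Lemma posdef_unit (X : 'M[R]_n) : posdef X -> X \in unitmx.
Proof.
by move=> /cholesky[L [Lu _ ->]]; rewrite unitmx_mul Lu unitmx_tr.
Qed.

(** Congruence by a Cholesky factor of X, with v transformed accordingly, reduces the bound to X =
    1, where it is [qform_sqr_le]. *)
Lemma qform_speed (X H : 'M[R]_n) v : posdef X -> H^T = H -> v != 0 ->
  `|qform v H / qform v X| <= Num.sqrt (sqspeed X H).
Proof.
move=> Xp Hs v0; have qX : 0 < qform v X by apply Xp.
rewrite normrM normfV (gtr0_norm qX) ler_pdivrMr//.
have [L [Lu _ XE]] := cholesky Xp.
have LTu : L^T \in unitmx by rewrite unitmx_tr.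
pose S := invmx L *m H *m (invmx L)^T.
have Ss : S^T = S by rewrite /S !trmx_mul trmxK Hs mulmxA.
have HE : H = L *m S *m L^T.
  by rewrite /S trmx_inv !mulmxA mulmxV// mul1mx mulmxKV.
have {}XE : X = L *m 1%:M *m L^T by rewrite mulmx1.
have := qform_sqr_le (L^T *m v) Ss; rewrite -!qform_congr -XE -HE.
have -> : \tr (S *m S) = sqspeed X H.
  by rewrite XE HE sqspeed_congr ?unitmx1// /sqspeed invmx1 !mulmx1.
move=> le2; rewrite -[leLHS]sqrtr_sqr (le_trans (ler_wsqrtr le2))//.
by rewrite sqrtrM ?sqr_ge0// sqrtr_sqr gtr0_norm// mulrC.
Qed.

End Speed.

(** * Length of arcs *)

Section Arcs.
Variables (R : realType) (n : nat).
Implicit Types (gamma : R -> 'M[R]_n) (v : 'cV[R]_n).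

Lemma is_derive_entry gamma t i j : derivable gamma t 1 ->
  is_derive t 1 (fun s => gamma s i j) (derive1 gamma t i j).
Proof.
move=> dg; have dij := (derivable_mxP gamma t 1).1 dg i j.
apply: DeriveDef => //; rewrite derive1E derive_mx// mxE.
by [].
Qed.

Lemma qformE v (X : 'M[R]_n) :
  qform v X = \sum_(j < n) \sum_(i < n) v j 0 * v i 0 * X i j.
Proof.
rewrite /qform mxE; apply: eq_bigr => j _; rewrite mxE big_distrl/=.
by apply: eq_bigr => i _; rewrite mxE mulrC mulrA.
Qed.

Lemma is_derive_qform gamma t v : derivable gamma t 1 ->
  is_derive t 1 (fun s => qform v (gamma s)) (qform v (derive1 gamma t)).
Proof.
move=> dg; rewrite qformE.
have -> : (fun s => qform v (gamma s)) =
    \sum_(j < n) \sum_(i < n) (v j 0 * v i 0 \*: (fun s => gamma s i j)).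
  apply/funext => s; rewrite qformE fct_sumE; apply: eq_bigr => j _.
  by rewrite fct_sumE.
apply: is_derive_sum => j; apply: is_derive_sum => i.
by apply: is_deriveZ; exact: is_derive_entry.
Qed.

Lemma cvg_sqspeed (T : Type) (F : set_system T) {FF : Filter F}
    (X H : T -> 'M[R]_n) (X0 H0 : 'M[R]_n) : X0 \in unitmx ->
  X x @[x --> F] --> X0 -> H x @[x --> F] --> H0 ->
  sqspeed (X x) (H x) @[x --> F] --> sqspeed X0 H0.
Proof.
move=> X0u XX HH; have XV : invmx (X x) @[x --> F] --> invmx X0 by exact: cvg_invmx.
exact: (cvg_mxtrace (cvg_mulmx (cvg_mulmx (cvg_mulmx HH XV) HH) XV)).
Qed.

Lemma cvg_qform (T : Type) (F : set_system T) {FF : Filter F}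
    (X : T -> 'M[R]_n) (X0 : 'M[R]_n) v :
  X x @[x --> F] --> X0 -> qform v (X x) @[x --> F] --> qform v X0.
Proof.
move=> XX; have /cvg_mxP/(_ 0 0) : v^T *m X x *m v @[x --> F] --> v^T *m X0 *m v.
  have XvX : v^T *m X x @[x --> F] --> v^T *m X0.
    by apply: (@cvg_mulmx _ _ _ _ _ _ _ (fun=> v^T)) => //; exact: cvg_cst.
  by apply: (@cvg_mulmx _ _ _ _ _ _ _ _ (fun=> v)) => //; exact: cvg_cst.
exact.
Qed.

Lemma derivable_mx_continuous gamma t : derivable gamma t 1 ->
  gamma s @[s --> t] --> gamma t.
Proof.
move=> dg; apply/cvg_mxP => i j.
have /derivable1_diffP/differentiable_continuous := (derivable_mxP gamma t 1).1 dg i j.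
exact.
Qed.

Lemma arc_speed_continuous gamma t : C1_arc gamma -> 0 <= t <= 1 ->
  {for t, continuous (fun s => Num.sqrt (sqspeed (gamma s) (derive1 gamma s)))}.
Proof.
move=> [dg cg pg] t01; apply: (@cvg_comp _ _ _ _ (@Num.sqrt R)); last first.
  exact: sqrt_continuous.
apply: cvg_sqspeed; first by apply: posdef_unit; exact: pg.
  exact: derivable_mx_continuous.
exact: cg.
Qed.

Lemma continuous_integrable01 (f : R -> R) :
  (forall t : R, 0 <= t <= 1 -> {for t, continuous f}) ->
  lebesgue_measure.-integrable `[0, 1] (EFin \o f).
Proof.
move=> cf; apply: continuous_compact_integrable; first exact: segment_compact.
apply: continuous_in_subspaceT => t; rewrite inE/= in_itv/=.
exact: cf.
Qed.

(** Symmetry of [gamma] is known on [0, 1] only, and differentiating it requires a neighbourhood of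
    t inside that interval. *)
Lemma arc_deriv_sym gamma t : C1_arc gamma -> 0 < t < 1 ->
  (derive1 gamma t)^T = derive1 gamma t.
Proof.
move=> [dg cg pg] t01; apply/matrixP => i j; rewrite mxE.
rewrite -(@derive_val _ _ _ _ _ _ _ (is_derive_entry i j (dg t))).
rewrite -(@derive_val _ _ _ _ _ _ _ (is_derive_entry j i (dg t))).
apply: near_eq_derive.
have : t \in `]0, 1[ by rewrite in_itv.
move=> /near_in_itvoo; apply: filterS => s; rewrite in_itv/= => /andP[s0 s1].
have [gs _] : posdef (gamma s) by apply: pg; rewrite !ltW.
by rewrite -[in LHS]gs mxE.
Qed.

Lemma arc_length_ge0 gamma : 0 <= arc_length gamma.
Proof. by apply: Rintegral_ge0 => t _; exact: sqrtr_ge0. Qed.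

(* |(ln v^T X v)'| is at most the speed. *)
Lemma arc_length_lb gamma v : C1_arc gamma -> v != 0 ->
  `|ln (qform v (gamma 1)) - ln (qform v (gamma 0))| <= arc_length gamma.
Proof.
move=> C1g v0; have [dg cg pg] := C1g.
pose q s := qform v (gamma s); pose dq s := qform v (derive1 gamma s).
have q0 (t : R) : 0 <= t <= 1 -> 0 < q t by move=> t01; apply pg.
pose f s := dq s / q s.
have q_cts t : {for t, continuous q}.
  by apply: cvg_qform; exact: derivable_mx_continuous.
have f_cts (t : R) : 0 <= t <= 1 -> {for t, continuous f}.
  move=> t01; apply: cvgM; last first.
    by apply: cvgV; [rewrite gt_eqF// q0|exact: q_cts].
  by apply: cvg_qform; exact: cg.
have lnq_cts (t : R) : 0 <= t <= 1 -> {for t, continuous (@ln R \o q)}.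
  move=> t01; apply: continuous_comp; first exact: q_cts.
  by apply: continuous_ln; exact: q0.
have dlnq (t : R) : 0 <= t <= 1 -> is_derive t 1 (@ln R \o q) (f t).
  move=> t01; rewrite /f mulrC; apply: is_derive1_comp.
    by apply: is_derive1_ln; exact: q0.
  exact: is_derive_qform.
have FTC : (\int[lebesgue_measure]_(x in `[0, 1]) f x = ln (q 1) - ln (q 0))%R.
  rewrite /Rintegral (@continuous_FTC2 _ f (@ln R \o q))//.
  - apply: continuous_in_subspaceT => t; rewrite inE/= in_itv/=; exact: f_cts.
  - split.
    + move=> t; rewrite in_itv/= => /andP[t0 t1].
      by apply: ex_derive; apply: dlnq; rewrite !ltW.
    + by apply: cvg_at_right_filter; apply: lnq_cts; rewrite lexx ler01.
    + by apply: cvg_at_left_filter; apply: lnq_cts; rewrite lexx ler01.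
  - move=> t; rewrite in_itv/= => /andP[t0 t1].
    by rewrite derive1E; apply: derive_val; apply: dlnq; rewrite !ltW.
rewrite -[ln _]/(ln (q 1)) -[X in _ - X]/(ln (q 0)) -FTC.
have fint := continuous_integrable01 f_cts.
have sint := continuous_integrable01 (fun t => @arc_speed_continuous gamma t C1g).
apply: (le_trans (le_normr_Rintegral _ fint)) => //.
(* The endpoints are discarded as a null set: the pointwise bound uses the symmetry of the
   derivative, established in the open interval. *)
have shrink (h : R -> R) : lebesgue_measure.-integrable `[0, 1] (EFin \o h) ->
    \int[lebesgue_measure]_(t in `[0, 1]) h t =
    \int[lebesgue_measure]_(t in `]0, 1[) h t.
  move=> hint; rewrite -Rintegral_itv_bndo_bndc; last first.
    by apply: integrableS hint => //; apply: subset_itvl; rewrite bnd_simp.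
  rewrite Rintegral_itv_obnd_cbnd//.
  by apply: integrableS hint => //; apply: subset_itv; rewrite bnd_simp.
rewrite /arc_length (shrink _ (integrable_norm fint)).
rewrite [leRHS]shrink//.
have sub : ([set` `]0%R, 1%R[] : set R) `<=` [set` `[0%R, 1%R]].
  by apply: subset_itv; rewrite bnd_simp.
apply: le_Rintegral => //.
- by move: (integrable_norm fint); apply: integrableS => //; exact: sub.
- by move: sint; apply: integrableS => //; exact: sub.
move=> t; rewrite /= in_itv/= => t01.
apply: qform_speed => //.
  by apply: pg; case/andP: t01 => t0 t1; rewrite !ltW.
exact: arc_deriv_sym.
Qed.

End Arcs.

(** * The Riemannian distance *)

Section Rho.
Variables (R : realType) (n : nat).
Implicit Types (gamma : R -> 'M[R]_n) (v : 'cV[R]_n) (X Y Z h : 'M[R]_n).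

Lemma is_derive_mx gamma (t : R) (D : 'M[R]_n) :
  (forall i j, is_derive t 1 (fun s => gamma s i j) (D i j)) ->
  is_derive t 1 gamma D.
Proof.
move=> dg; have d : derivable gamma t 1 by apply/derivable_mxP => i j; exact: ex_derive.
apply: DeriveDef => //; rewrite derive_mx//; apply/matrixP => i j; rewrite mxE.
exact: derive_val.
Qed.

Lemma is_derive1_mx gamma (t : R) (D : 'M[R]_n) : is_derive t 1 gamma D ->
  derivable gamma t 1 /\ derive1 gamma t = D.
Proof. by move=> dg; split; [exact: ex_derive|rewrite derive1E; exact: derive_val]. Qed.

Lemma is_derive_congr gamma (t : R) h : derivable gamma t 1 ->
  is_derive t 1 (fun s => h *m gamma s *m h^T) (h *m derive1 gamma t *m h^T).
Proof.
move=> dg; apply: is_derive_mx => i j.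
have E X : (h *m X *m h^T) i j = \sum_(l < n) \sum_(k < n) h j l * h i k * X k l.
  rewrite mxE; apply: eq_bigr => l _; rewrite mxE big_distrl/=.
  by apply: eq_bigr => k _; rewrite mxE mulrC mulrA.
rewrite E; under eq_fun do rewrite E.
have -> : (fun s => \sum_(l < n) \sum_(k < n) h j l * h i k * gamma s k l) =
    \sum_(l < n) \sum_(k < n) (h j l * h i k \*: (fun s => gamma s k l)).
  apply/funext => s; rewrite fct_sumE; apply: eq_bigr => l _.
  by rewrite fct_sumE.
apply: is_derive_sum => l; apply: is_derive_sum => k.
by apply: is_deriveZ; exact: is_derive_entry.
Qed.

Lemma C1_arc_congr gamma h : h \in unitmx -> C1_arc gamma ->
  C1_arc (fun s => h *m gamma s *m h^T).
Proof.
move=> hu [dg cg pg]; split.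
- by move=> t; have [] := is_derive1_mx (is_derive_congr h (dg t)).
- have -> : derive1 (fun s => h *m gamma s *m h^T) =
      (fun s => h *m derive1 gamma s *m h^T).
    by apply/funext => t; have [] := is_derive1_mx (is_derive_congr h (dg t)).
  move=> t; have hg : h *m derive1 gamma s @[s --> t] --> h *m derive1 gamma t.
    by apply: (@cvg_mulmx _ _ _ _ _ _ _ (fun=> h)); [exact: cvg_cst|exact: cg].
  by apply: (@cvg_mulmx _ _ _ _ _ _ _ _ (fun=> h^T)) => //; exact: cvg_cst.
- by move=> t t01; apply: posdef_congr => //; exact: pg.
Qed.

Lemma arc_length_congr gamma h : h \in unitmx -> C1_arc gamma ->
  arc_length (fun s => h *m gamma s *m h^T) = arc_length gamma.
Proof.
move=> hu [dg cg pg]; apply: eq_Rintegral => t; rewrite inE/= in_itv/= => t01.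
have [_ ->] := is_derive1_mx (is_derive_congr h (dg t)).
by congr Num.sqrt; exact: (sqspeed_congr _ hu (posdef_unit (pg t t01))).
Qed.

Lemma path_length_congr X Y L h : h \in unitmx -> path_length X Y L ->
  path_length (h *m X *m h^T) (h *m Y *m h^T) L.
Proof.
move=> hu; elim=> [Z|gamma Z M C1g _ IH]; first exact: path_nil.
rewrite -(arc_length_congr hu C1g).
exact: (@path_cons _ _ (fun s => h *m gamma s *m h^T)) (C1_arc_congr hu C1g) IH.
Qed.

Lemma path_length_ge0 X Y L : path_length X Y L -> 0 <= L.
Proof.
by elim=> // gamma Z M _ _ M0; rewrite addr_ge0// arc_length_ge0.
Qed.

Lemma path_length_cat X Y Z L M :
  path_length X Y L -> path_length Y Z M -> path_length X Z (L + M).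
Proof.
move=> XY; elim: XY Z M => [A Z M|gamma A N C1g _ IH Z M AZ]; first by rewrite add0r.
by rewrite -addrA; apply: path_cons => //; exact: IH.
Qed.

Lemma path_length_lb X Y L v : path_length X Y L -> v != 0 ->
  `|ln (qform v X) - ln (qform v Y)| <= L.
Proof.
move=> XY v0; elim: XY => [Z|gamma Z M C1g _ IH]; first by rewrite subrr normr0.
rewrite -(subrKA (ln (qform v (gamma 1)))) (le_trans (ler_normD _ _))//.
by rewrite lerD// distrC arc_length_lb.
Qed.

Definition segment X Y (t : R) : 'M[R]_n := X + t *: (Y - X).

Lemma is_derive_segment X Y (t : R) : is_derive t 1 (segment X Y) (Y - X).
Proof.
apply: is_derive_mx => i j.
have -> : (fun s => segment X Y s i j) = cst (X i j) + (Y - X) i j \*: id.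
  by apply/funext => s; rewrite !mxE/= mulrC.
by rewrite -[X in is_derive _ _ _ X]add0r -[X in 0 + X]mulr1; apply: is_deriveD.
Qed.

Lemma posdef_segment X Y (t : R) : posdef X -> posdef Y -> 0 <= t <= 1 ->
  posdef (segment X Y t).
Proof.
move=> [Xs Xp] [Ys Yp] /andP[t0 t1].
have -> : segment X Y t = (1 - t) *: X + t *: Y.
  by rewrite /segment scalerBr scalerBl scale1r -addrA [- _ + _]addrC.
split; first by rewrite linearD/= !linearZ/= Xs Ys.
move=> v v0; rewrite mulmxDr mulmxDl -!scalemxAr -!scalemxAl.
rewrite [ltRHS]mxE [X in X + _]mxE [X in _ + X]mxE.
have X0 := Xp v v0; have Y0 := Yp v v0.
have [->|t0'] := eqVneq t 0; first by rewrite subr0 mul1r mul0r addr0.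
have tp : 0 < t by rewrite lt_neqAle eq_sym t0'.
by rewrite ltr_wpDl ?mulr_gt0// mulr_ge0 ?subr_ge0 ?(ltW X0).
Qed.

Lemma C1_arc_segment X Y : posdef X -> posdef Y -> C1_arc (segment X Y).
Proof.
move=> Xp Yp; split.
- by move=> t; have [] := is_derive1_mx (is_derive_segment X Y t).
- have -> : derive1 (segment X Y) = cst (Y - X).
    by apply/funext => t; have [] := is_derive1_mx (is_derive_segment X Y t).
  by move=> t; exact: cvg_cst.
- by move=> t; exact: posdef_segment.
Qed.

Lemma path_length_segment X Y : posdef X -> posdef Y ->
  path_length X Y (arc_length (segment X Y)).
Proof.
move=> Xp Yp; have s0 : segment X Y 0 = X by rewrite /segment scale0r addr0.
have s1 : segment X Y 1 = Y by rewrite /segment scale1r addrC subrK.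
rewrite -[X in path_length X _ _]s0 -[arc_length _]addr0.
by apply: path_cons; [exact: C1_arc_segment|rewrite s1; exact: path_nil].
Qed.

Lemma path_length_lbound X Y : lbound [set L | path_length X Y L] 0.
Proof. by move=> L /path_length_ge0. Qed.

Lemma has_inf_path_length X Y : posdef X -> posdef Y ->
  has_inf [set L | path_length X Y L].
Proof.
move=> Xp Yp; split; first by eexists; exact: path_length_segment.
by exists 0; exact: path_length_lbound.
Qed.

Lemma rho_ge0 X Y : posdef X -> posdef Y -> 0 <= rho X Y.
Proof.
move=> Xp Yp; apply: lb_le_inf; last exact: path_length_lbound.
by have [] := has_inf_path_length Xp Yp.
Qed.

Lemma rho_le X Y L : path_length X Y L -> rho X Y <= L.
Proof. by apply: ge_inf; exists 0; exact: path_length_lbound. Qed.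

Lemma rho_lt X Y (d : R) : posdef X -> posdef Y -> rho X Y < d ->
  exists2 L, path_length X Y L & L < d.
Proof.
move=> Xp Yp; rewrite -subr_gt0 => /inf_adherent/(_ (has_inf_path_length Xp Yp)).
by move=> [L XYL]; rewrite addrC subrK => Ld; exists L.
Qed.

Lemma rho_triangle X Y Z : posdef X -> posdef Y -> posdef Z ->
  rho X Z <= rho X Y + rho Y Z.
Proof.
move=> Xp Yp Zp; apply/ler_addgt0Pr => e e0.
have e2 : 0 < e / 2 by rewrite divr_gt0.
have [L XYL Ld] : exists2 L, path_length X Y L & L < rho X Y + e / 2.
  by apply: rho_lt => //; rewrite ltrDl.
have [M YZM Md] : exists2 M, path_length Y Z M & M < rho Y Z + e / 2.
  by apply: rho_lt => //; rewrite ltrDl.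
apply: (le_trans (rho_le (path_length_cat XYL YZM))).
by rewrite (splitr e) addrACA lerD// ltW.
Qed.

Lemma rho_congr X Y h : h \in unitmx ->
  rho (h *m X *m h^T) (h *m Y *m h^T) = rho X Y.
Proof.
move=> hu; congr inf; apply/seteqP; split => L; last exact: path_length_congr.
have hVu : invmx h \in unitmx by rewrite unitmx_inv.
move=> /(path_length_congr hVu).
have E Z : invmx h *m (h *m Z *m h^T) *m (invmx h)^T = Z.
  by rewrite trmx_inv !mulmxA mulVmx// mul1mx mulmxK// unitmx_tr.
by rewrite !E.
Qed.

(** Apart from nonnegativity, the only lower bound on [rho] in use. The strict inequality yields an
    actual path shorter than d, although the infimum may not be attained. *)
Lemma rho_qform X Y v (d : R) : posdef X -> posdef Y -> v != 0 -> rho X Y < d ->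
  `|ln (qform v X) - ln (qform v Y)| < d.
Proof.
move=> Xp Yp v0 /(rho_lt Xp Yp)[L XYL]; apply: le_lt_trans.
exact: path_length_lb.
Qed.

Lemma segment_dist X Y (t : R) : 0 <= t <= 1 ->
  `|X - segment X Y t| <= `|X - Y| /\ `|Y - segment X Y t| <= `|X - Y|.
Proof.
move=> /andP[t0 t1]; split.
  rewrite /segment opprD addNKr normrN normrZ (ger0_norm t0) distrC.
  by rewrite ler_piMl.
have -> : Y - segment X Y t = (1 - t) *: (Y - X).
  by rewrite /segment opprD addrA scalerBl scale1r.
by rewrite normrZ ger0_norm ?subr_ge0// distrC ler_piMl// gerBl.
Qed.

(** [sqspeed] is continuous and vanishes at (X, 0), so a short segment close to X is traversed in
    unit time at speed at most e. Stating both orders avoids an appeal to the symmetry of [rho]. *)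
Lemma rho_near X (e : R) : posdef X -> 0 < e ->
  \forall Y \near X, posdef Y -> rho X Y <= e /\ rho Y X <= e.
Proof.
move=> Xp e0.
have Xu := posdef_unit Xp.
have : sqspeed z.1 z.2 @[z --> (X, 0 : 'M[R]_n)] --> sqspeed X 0.
  by apply: cvg_sqspeed => //; [exact: cvg_fst|exact: cvg_snd].
rewrite {2}/sqspeed mul0mx mul0mx mul0mx mxtrace0.
have e2 : 0 < e ^+ 2 by rewrite exprn_gt0.
move=> /cvgr0_norm_lt/(_ _ e2)[[A B] [/=]].
move=> /nbhs_ballP[d1 /= d1_gt0 A1] /nbhs_ballP[d2 /= d2_gt0 B2] AB.
pose d := Num.min d1 d2; have d0 : 0 < d by rewrite lt_min d1_gt0.
have small Z H : `|X - Z| < d -> `|H| < d -> Num.sqrt (sqspeed Z H) <= e.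
  rewrite !lt_min => /andP[Zd1 _] /andP[_ Hd2].
  have /ltW le2 : `|sqspeed Z H| < e ^+ 2.
    apply: (AB (Z, H)); split; [apply: A1|apply: B2]; rewrite -ball_normE//=.
    by rewrite sub0r normrN.
  rewrite -[leRHS]ger0_norm ?(ltW e0)// -sqrtr_sqr ler_wsqrtr//.
  exact: le_trans (ler_norm _) le2.
have bound Y Z : posdef Y -> posdef Z -> `|Y - Z| < d ->
    (forall t : R, 0 <= t <= 1 -> `|X - segment Y Z t| < d) -> rho Y Z <= e.
  move=> Yp Zp YZd Xd; apply: le_trans (rho_le (path_length_segment Yp Zp)) _.
  have C1 := C1_arc_segment Yp Zp.
  have -> : e = \int[lebesgue_measure]_(t in `[0%R, 1%R]) e.
    rewrite Rintegral_cst//= lebesgue_measure_itv/= lte_fin ltr01 oppr0 adde0.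
    by rewrite mulr1.
  apply: le_Rintegral => //.
  - exact: (continuous_integrable01 (fun t => @arc_speed_continuous _ _ _ t C1)).
  - by apply: (@continuous_integrable01 _ (cst e)) => t _; exact: cvg_cst.
  move=> t; rewrite /= in_itv/= => t01.
  have [_ ->] := is_derive1_mx (is_derive_segment Y Z t).
  by apply: small; [exact: Xd|rewrite distrC].
apply/nbhs_ballP; exists d => // Y; rewrite -ball_normE/= => XYd Yp; split.
  apply: bound => // t t01; apply: le_lt_trans XYd.
  by have [] := segment_dist X Y t01.
apply: bound => //; first by rewrite distrC.
move=> t t01; apply: le_lt_trans XYd; rewrite [leRHS]distrC.
by have [] := segment_dist Y X t01.
Qed.

End Rho.

(** * Growth exponents along asymptotic geodesics *)

Section Asymptotics.
Variables (R : realType) (n : nat).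
Implicit Types (mu nu : R -> 'M[R]_n) (g h k : 'M[R]_n) (phi : 'rV[R]_n).
Implicit Types (v : 'cV[R]_n).

Definition expd phi (t : R) : 'M[R]_n := diag_mx (\row_j expR (phi 0 j * t)).

Lemma expdD phi (s t : R) : expd phi s *m expd phi t = expd phi (s + t).
Proof.
rewrite /expd mulmx_diag; congr diag_mx; apply/rowP => j.
by rewrite !mxE -expRD mulrDr.
Qed.

Lemma expd0 phi : expd phi 0 = 1%:M.
Proof.
by apply/matrixP => i j; rewrite !mxE mulr0 expR0.
Qed.

Lemma expd_unit phi t : expd phi t \in unitmx.
Proof.
by have := expdD phi t (- t); rewrite subrr expd0 => /mulmx1_unit[].
Qed.

Lemma tr_expd phi t : (expd phi t)^T = expd phi t.
Proof. exact: tr_diag_mx. Qed.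

Lemma posdef_geodesic g phi t : g \in unitmx -> posdef (g *m expd phi t *m g^T).
Proof.
move=> gu; apply: posdef_congr => //.
rewrite [t]splitr -expdD -{2}tr_expd; apply: posdef_gram; exact: expd_unit.
Qed.

(** With w = g^T v the form is the sum of w_j^2 e^(phi_j t); for t >= 0 it lies between its dominant
    term w_i^2 e^(phi_i t) and |w|^2 e^(phi_i t). *)
Lemma qform_growth g phi v i : v != 0 -> (g^T *m v) i 0 != 0 ->
  (forall j, (g^T *m v) j 0 != 0 -> phi 0 j <= phi 0 i) ->
  exists C : R, forall t, 0 <= t ->
    `|ln (qform v (g *m expd phi t *m g^T)) - phi 0 i * t| <= C.
Proof.
move=> v0 wi imax; set w := g^T *m v in wi imax.
have qE t : qform v (g *m expd phi t *m g^T) = \sum_j w j 0 ^+ 2 * expR (phi 0 j * t).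
  rewrite qform_congr -/w /qform mul_mx_diag mxE; apply: eq_bigr => j _.
  by rewrite !mxE expr2 mulrAC.
pose S := \sum_j w j 0 ^+ 2.
have wi2 : 0 < w i 0 ^+ 2 by rewrite exprn_even_gt0.
have S0 : 0 < S.
  by rewrite /S (bigD1 i)//= ltr_pwDl// sumr_ge0// => j _; rewrite sqr_ge0.
exists (`|ln (w i 0 ^+ 2)| + `|ln S|) => t t0.
have lo : w i 0 ^+ 2 * expR (phi 0 i * t) <= qform v (g *m expd phi t *m g^T).
  rewrite qE (bigD1 i)//= lerDl sumr_ge0// => j _.
  by rewrite mulr_ge0 ?sqr_ge0 ?expR_ge0.
have up : qform v (g *m expd phi t *m g^T) <= S * expR (phi 0 i * t).
  rewrite qE /S big_distrl/=; apply: ler_sum => j _.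
  have [->|/imax ji] := eqVneq (w j 0) 0; first by rewrite expr0n/= !mul0r.
  by rewrite ler_wpM2l ?sqr_ge0// ler_expR ler_wpM2r.
have lo0 : 0 < w i 0 ^+ 2 * expR (phi 0 i * t) by rewrite mulr_gt0 ?expR_gt0.
have q0 := lt_le_trans lo0 lo.
have up0 := lt_le_trans q0 up.
move: lo up; rewrite -[_ <= qform _ _]ler_ln// -[qform _ _ <= _]ler_ln//.
have lnexp (x : R) : 0 < x -> ln (x * expR (phi 0 i * t)) = ln x + phi 0 i * t.
  by move=> x0; rewrite lnM ?posrE ?expR_gt0// expRK.
rewrite !lnexp// => lo up.
rewrite ler_norml; apply/andP; split.
  rewrite lerBrDr; apply: le_trans lo; rewrite lerD2r.
  rewrite lerNl (le_trans (ler_norm _))// normrN lerDl//.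
rewrite lerBlDr; apply: (le_trans up); rewrite lerD2r.
by rewrite (le_trans (ler_norm _))// lerDr.
Qed.

Lemma bounded_ray_le0 (x C t0 : R) : (forall t, t0 <= t -> x * t <= C) -> x <= 0.
Proof.
move=> xC; rewrite leNgt; apply/negP => x0.
have := xC (`|t0| + `|C / x| + 1).
have -> : t0 <= `|t0| + `|C / x| + 1.
  by rewrite -addrA (le_trans (ler_norm _))// lerDl addr_ge0.
move=> /(_ isT); apply/negP; rewrite -ltNge.
rewrite -[ltLHS](divfK (lt0r_neq0 x0)) mulrC ltr_pM2l//.
by rewrite (le_lt_trans (ler_norm _))// ltr_pwDr// lerDr.
Qed.

(** Distances converging to d are eventually below d + 1, and an infimum below d + 1 is undercut by
    a point of the ray. *)
Lemma asymptotic_bounded mu nu g phi h phi' :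
  geodesic_rep mu g phi -> geodesic_rep nu h phi' -> asymptotic mu nu ->
  exists (d t0 : R), 0 <= t0 /\ forall t, t0 <= t ->
    exists2 s, 0 <= s & rho (mu t) (nu s) < d.
Proof.
move=> [gu _ _ muE] [hu _ _ nuE] [d /cvgrPdist_lt/(_ _ ltr01)].
move=> [t0 [_ t0P]]; exists (d + 1), (`|t0| + 1); split; first by rewrite addr_ge0.
move=> t tt0; have {t0P} : `|d - dist_to_ray (mu t) nu| < 1.
  apply: t0P; apply: lt_le_trans tt0.
  by rewrite (le_lt_trans (ler_norm _))// ltrDl.
rewrite distrC => /(le_lt_trans (ler_norm _)); rewrite ltrBlDl => dlt.
have inf_ok : has_inf [set rho (mu t) (nu s) | s in [set s : R | 0 <= s]].
  split; first by exists (rho (mu t) (nu 0)), 0 => /=.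
  exists 0 => _ [s _ <-]; apply: rho_ge0; rewrite ?muE ?nuE; exact: posdef_geodesic.
have : 0 < d + 1 - dist_to_ray (mu t) nu by rewrite subr_gt0.
move=> /inf_adherent/(_ inf_ok)[_ [s s0 <-]].
by rewrite addrC subrK => lt; exists s.
Qed.

(* If s(t) keeps nu(s(t)) at bounded distance from mu(t), then the growth
   exponents lam and lam' of v^T mu(t) v and v^T nu(t) v satisfy
   lam t - lam' s(t) = O(1), for every v and with the same s(t). *)
Lemma asymptotic_lowsp mu nu g phi h phi' :
  geodesic_rep mu g phi -> geodesic_rep nu h phi' -> asymptotic mu nu ->
  exists2 a : R, 0 < a & forall c, lowsp g phi (a * c) = lowsp h phi' c.
Proof.
move=> Gmu Gnu as_mn.
have [d [t0 [t0_ge0 near_s]]] := asymptotic_bounded Gmu Gnu as_mn.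
have [gu _ phi0 muE] := Gmu; have [hu _ _ nuE] := Gnu.
(* s(t) is fixed before any v is considered, so that all exponents are compared along the same
   function. *)
have /choice[s sP] : forall t, exists s, t0 <= t -> 0 <= s /\ rho (mu t) (nu s) < d.
  move=> t; have [/near_s[s s0 sd]|_] := leP t0 t; first by exists s.
  by exists 0.
have key v i i' : v != 0 ->
    (g^T *m v) i 0 != 0 -> (forall j, (g^T *m v) j 0 != 0 -> phi 0 j <= phi 0 i) ->
    (h^T *m v) i' 0 != 0 -> (forall j, (h^T *m v) j 0 != 0 -> phi' 0 j <= phi' 0 i') ->
    exists C, forall t, t0 <= t -> `|phi 0 i * t - phi' 0 i' * s t| <= C.
  move=> v0 vi imax vi' imax'.
  have [C1 C1P] := qform_growth v0 vi imax.
  have [C2 C2P] := qform_growth v0 vi' imax'.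
  exists (C1 + d + C2) => t tt0; have [st0 std] := sP t tt0.
  have {}C1P := C1P t (le_trans t0_ge0 tt0); have {}C2P := C2P _ st0.
  have mup : posdef (mu t) by rewrite muE; exact: posdef_geodesic.
  have nup : posdef (nu (s t)) by rewrite nuE; exact: posdef_geodesic.
  have := rho_qform mup nup v0 std; rewrite muE nuE => /ltW C3P.
  move: C1P C2P C3P; rewrite /expd; move: (ln _) (ln _) => x y; rewrite !ler_norml.
  by move: (phi 0 i * t) (phi' 0 i' * s t) => z w; lra.
have [j0 pj0] : exists j, phi 0 j != 0.
  apply/existsP; apply: contraR phi0; rewrite negb_exists => /forallP p0.
  by apply/eqP/rowP => j; rewrite [RHS]mxE; apply/eqP; have := p0 j; rewrite negbK.
(* The calibrating vector: its exponent along mu is p = phi_j0, nonzero, so its exponent p' along nu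
   will give s(t) = p t / p' up to a bounded error. *)
have v00 := dualv_neq0 j0 gu.
have [i0 vi0 imax0] := dominant_coord phi' hu v00.
set p := phi 0 j0 in pj0; set p' := phi' 0 i0.
have [C0 C0P] : exists C, forall t, t0 <= t -> `|p * t - p' * s t| <= C.
  apply: key v00 _ _ vi0 imax0; first by rewrite mul_dualv// eqxx oner_eq0.
  by move=> j; rewrite mul_dualv//; have [->|] := eqVneq j j0; rewrite // eqxx.
(* If p p' <= 0, then p t and - p' s(t) never have opposite signs, because s(t) >= 0, and |p| t
   would be bounded. *)
have pp : 0 < p * p'.
  rewrite ltNge; apply/negP => pp0.
  have : `|p| <= 0.
    apply: (@bounded_ray_le0 _ C0 t0) => t tt0; have [st0 _] := sP t tt0.
    apply: le_trans (C0P t tt0); have tge := le_trans t0_ge0 tt0.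
    move: (pj0); rewrite neq_lt => /orP[pn|pn].
      have p'0 : 0 <= p' by rewrite -(nmulr_rle0 _ pn).
      rewrite ltr0_norm// -normrN ler_normr; apply/orP; left.
      by have := mulr_ge0 p'0 st0; lra.
    have p'0 : p' <= 0 by rewrite -(pmulr_rle0 _ pn).
    rewrite gtr0_norm// ler_normr; apply/orP; left.
    by have := mulr_le0_ge0 p'0 st0; lra.
  by rewrite normr_le0 (negbTE pj0).
have p'0 : p' != 0 by apply: contraTneq pp => ->; rewrite mulr0 ltxx.
pose a := p / p'; have a0 : 0 < a.
  have -> : a = p * p' * p'^-1 ^+ 2 by rewrite /a; field.
  by rewrite mulr_gt0// exprn_even_gt0//= invr_neq0.
have lam v i i' : v != 0 ->
    (g^T *m v) i 0 != 0 -> (forall j, (g^T *m v) j 0 != 0 -> phi 0 j <= phi 0 i) ->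
    (h^T *m v) i' 0 != 0 -> (forall j, (h^T *m v) j 0 != 0 -> phi' 0 j <= phi' 0 i') ->
    phi 0 i = a * phi' 0 i'.
  move=> v0 vi imax vi' imax'; have [C CP] := key v i i' v0 vi imax vi' imax'.
  set x := phi 0 i in CP *; set x' := phi' 0 i' in CP *.
  apply/eqP; rewrite -subr_eq0 -normr_le0.
  apply: (@bounded_ray_le0 _ (C + `|x' / p'| * C0) t0) => t tt0.
  have tge := le_trans t0_ge0 tt0; rewrite -{1}(ger0_norm tge) -normrM.
  (* Eliminates s(t) between the estimate for v and the one for the calibrating vector. *)
  have -> : (x - a * x') * t = (x * t - x' * s t) - x' / p' * (p * t - p' * s t).
    by rewrite /a; field.
  apply: (le_trans (ler_normB _ _)); rewrite lerD ?CP// normrM ler_wpM2l//.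
  exact: C0P.
exists a => // c; apply/vspaceP => v; have [->|v0] := eqVneq v 0.
  by rewrite !mem0v.
have [i vi imax] := dominant_coord phi gu v0.
have [i' vi' imax'] := dominant_coord phi' hu v0.
by rewrite (mem_lowsp _ vi imax) (mem_lowsp _ vi' imax') (lam v i i')// ler_pM2l.
Qed.

End Asymptotics.

(** * Geodesics asymptotic to a given one *)

Section QRAsymptotic.
Variables (R : realType) (n : nat).
Implicit Types (mu nu : R -> 'M[R]_n) (g h k : 'M[R]_n) (phi : 'rV[R]_n).

Lemma cvg_expR_neg (x : R) : x < 0 -> expR (x * t) @[t --> +oo] --> 0.
Proof.
move=> x0; apply/cvgrPdist_le => e e0; near=> t.
rewrite sub0r normrN ger0_norm ?expR_ge0// -[e]lnK ?posrE// ler_expR.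
by rewrite mulrC -ler_ndivrMr.
Unshelve. all: by end_near. Qed.

(* D(-t/2) b^T D(t/2) tends to the block diagonal part of b^T. *)
Lemma cvg_conj_trig (b : 'M[R]_n) phi : nonincreasing_row phi -> b \in unitmx ->
  is_trig_mx b -> exists2 B : 'M[R]_n, B \in unitmx &
  expd phi (- (t / 2)) *m b^T *m expd phi (t / 2) @[t --> +oo] --> B.
Proof.
move=> ninc bu bt.
(* Entry (i, j) of the conjugate is b_ji e^((phi_j - phi_i) t / 2): it vanishes for j < i, is
   constant for equal exponents and decays otherwise. *)
pose B := \matrix_(i, j < n) (b j i *+ (phi 0 i == phi 0 j)).
have /is_trig_mxP bt0 := bt.
exists B.
  have BTt : is_trig_mx B^T.
    by apply/is_trig_mxP => i j ij; rewrite !mxE bt0// mul0rn.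
  rewrite -unitmx_tr unitmxE det_trig//.
  under eq_bigr do rewrite !mxE eqxx mulr1n.
  by rewrite -det_trig// -unitmxE.
apply/cvg_mxP => i j; rewrite mxE.
have E t : (expd phi (- (t / 2)) *m b^T *m expd phi (t / 2)) i j =
    b j i * expR ((phi 0 j - phi 0 i) / 2 * t).
  rewrite mul_mx_diag mxE mul_diag_mx !mxE mulrAC mulrC -expRD; congr (_ * expR _).
  by field.
rewrite (funext E).
have [ji|ij] := ltnP j i.
  by rewrite bt0// mul0rn; under eq_fun do rewrite mul0r; exact: cvg_cst.
have [->|pij] := eqVneq (phi 0 i) (phi 0 j).
  by under eq_fun do rewrite subrr mul0r mul0r expR0 mulr1; exact: cvg_cst.
rewrite mulr0n -[X in _ --> X](mulr0 (b j i)); apply: cvgM; first exact: cvg_cst.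
apply: cvg_expR_neg; rewrite pmulr_llt0 ?invr_gt0// subr_lt0.
by rewrite lt_neqAle eq_sym pij ninc.
Qed.

(** Write D(u) for [expd phi u]. Congruence by D(-t/2) k^-1 turns the two points into X(t), which
    converges, and D(s - t). The constraint s >= 0 becomes u = s - t >= -t and fades as t grows, so
    the limit is the distance from lim X(t) to the whole curve D. *)
Lemma asymptotic_qr (k b : 'M[R]_n) phi : k \in unitmx -> b \in unitmx ->
  is_trig_mx b -> nonincreasing_row phi ->
  asymptotic (fun t => (k *m b^T) *m expd phi t *m (k *m b^T)^T)
             (fun t => k *m expd phi t *m k^T).
Proof.
move=> ku bu bt ninc; have [B Bu BB] := cvg_conj_trig ninc bu bt.
pose C t := expd phi (- (t / 2)) *m b^T *m expd phi (t / 2).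
pose X t := C t *m (C t)^T; pose X0 := B *m B^T.
have XX : X t @[t --> +oo] --> X0.
  apply: cvg_mulmx => //; apply/cvg_mxP => i j; rewrite mxE.
  by under eq_cvg do rewrite mxE; move/cvg_mxP: BB; apply.
have bTu : b^T \in unitmx by rewrite unitmx_tr.
have Xp t : posdef (X t).
  by apply: posdef_gram; rewrite !unitmx_mul !expd_unit bTu.
have X0p : posdef X0 by exact: posdef_gram.
have Dp u : posdef (expd phi u).
  by have := posdef_geodesic phi u (unitmx1 _ n); rewrite trmx1 mulmx1 mul1mx.
have rhoE t s : rho ((k *m b^T) *m expd phi t *m (k *m b^T)^T)
    (k *m expd phi s *m k^T) = rho (X t) (expd phi (s - t)).
  have -> : (k *m b^T) *m expd phi t *m (k *m b^T)^T =
      k *m (b^T *m expd phi t *m b) *m k^T.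
    by rewrite trmx_mul trmxK !mulmxA.
  rewrite rho_congr// -(rho_congr _ _ (expd_unit phi (- (t / 2)))) tr_expd.
  congr rho.
    rewrite /X /C !trmx_mul !tr_expd trmxK -!mulmxA; congr (_ *m (_ *m _)).
    by rewrite !mulmxA expdD -splitr.
  by rewrite !expdD; congr expd; field.
have rD_inf : has_inf [set rho X0 (expd phi u) | u in [set: R]].
  split; first by exists (rho X0 (expd phi 0)), 0.
  by exists 0 => _ [u _ <-]; exact: rho_ge0.
pose m := inf [set rho X0 (expd phi u) | u in [set: R]].
exists m; apply/cvgrPdist_le => e e0.
have e2 : 0 < e / 2 by rewrite divr_gt0.
have [_ [u0 _ <-]] := inf_adherent e2 rD_inf; rewrite -/m => u0m.
have Xe : \forall t \near +oo, rho X0 (X t) <= e / 2 /\ rho (X t) X0 <= e / 2.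
  have := XX _ (rho_near X0p e2); rewrite /nbhs/=; apply: filterS => t; exact.
near=> t.
have [Xe1 Xe2] : rho X0 (X t) <= e / 2 /\ rho (X t) X0 <= e / 2 by near: t.
(* Guarantees that the near-optimal point D(u0) comes from a parameter s = u0 + t >= 0 of the
   ray. *)
have tu0 : - u0 <= t by [].
rewrite distrC ler_distl; apply/andP; split.
  apply: lb_le_inf.
    by eexists; exists 0 => //=.
  move=> _ [s _ <-]; rewrite rhoE lerBlDr.
  have mle : m <= rho X0 (expd phi (s - t)).
    by apply: ge_inf; [exact: rD_inf.2|exists (s - t)].
  apply: (le_trans mle); rewrite [leRHS]addrC.
  rewrite (le_trans (rho_triangle X0p (Xp t) (Dp _)))//.
  by rewrite lerD2r (le_trans Xe1)// ler_pdivrMr// ler_peMr ?ler1n// ltW.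
have ray_lb : has_lbound [set rho ((k *m b^T) *m expd phi t *m (k *m b^T)^T)
     (k *m expd phi s *m k^T) | s in [set s : R | 0 <= s]].
  by exists 0 => _ [s _ <-]; rewrite rhoE; exact: rho_ge0.
apply: (@le_trans _ _ (rho (X t) (expd phi u0))).
  apply: ge_inf => //; exists (u0 + t) => /=; first by rewrite -lerBlDl sub0r.
  by rewrite rhoE addrK.
rewrite (le_trans (rho_triangle (Xp t) X0p (Dp _)))// [e]splitr addrCA lerD//.
by rewrite ltW.
Unshelve. all: by end_near. Qed.

(** D(a t + b) = D(b/2) D(a t) D(b/2): the shift is absorbed into g and the scaling into the
    exponents. *)
Lemma reparam_rep mu g phi nu : geodesic_rep mu g phi -> reparam mu nu ->
  exists a b, 0 < a /\ geodesic_rep nu (g *m expd phi (b / 2)) (a *: phi).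
Proof.
move=> [gu ninc phi0 muE] [a [b [a0 ->]]]; exists a, b; split=> //; split.
- by rewrite unitmx_mul gu expd_unit.
- by move=> i j ij; rewrite !mxE ler_pM2l// ninc.
- by rewrite scaler_eq0 negb_or gt_eqF.
move=> t; rewrite muE.
have -> : diag_mx (\row_j expR ((a *: phi) 0 j * t)) = expd phi (a * t).
  by congr diag_mx; apply/rowP => j; rewrite !mxE; congr expR; ring.
rewrite trmx_mul tr_expd -/(expd phi (a * t + b)).
rewrite -!mulmxA; congr (_ *m _); rewrite !mulmxA; congr (_ *m _).
by rewrite !expdD; congr expd; field.
Qed.

Lemma is_derive_geodesic g phi :
  is_derive (0 : R) 1 (fun t => g *m expd phi t *m g^T) (g *m diag_mx phi *m g^T).
Proof.
have dE : is_derive (0 : R) 1 (expd phi) (diag_mx phi).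
  apply: is_derive_mx => i j; rewrite mxE.
  have -> : (fun s => expd phi s i j) = (fun s => expR (phi 0 i * s) *+ (i == j)).
    by apply/funext => s; rewrite !mxE.
  case: eqP => [_|_]; last first.
    by rewrite mulr0n; under eq_fun do rewrite mulr0n; exact: is_derive_cst.
  rewrite mulr1n; under eq_fun do rewrite mulr1n.
  rewrite -[X in is_derive _ _ _ X]mul1r.
  apply: (@is_derive1_comp _ expR (fun s => phi 0 i * s)).
    by rewrite mulr0 -[X in is_derive _ _ _ X]expR0; exact: is_derive_expR.
  rewrite -[X in is_derive _ _ _ X]mulr1.
  exact: is_deriveZ.
have [ddE <-] := is_derive1_mx dE.
exact: is_derive_congr.
Qed.

End QRAsymptotic.

(** * Adapted exponents *)

Section FlagFacts.
Variables (R : realType) (n : nat).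
Implicit Types (k g h : 'M[R]_n) (phi : 'rV[R]_n) (W : seq {vspace 'cV[R]_n}).

Lemma flag_sorted W : flag W -> sorted (@strict_sub R n) W.
Proof. by case. Qed.

Lemma flag_gt0 W : flag W -> (0 < n)%N.
Proof.
case: W => [|U [|V W]] [//= _ _ _ /andP[/andP[_ VU] _]].
rewrite lt0n; apply: contra VU => /eqP n0; apply/eqP/vspaceP => v.
have -> : v = 0 by apply/matrixP => i; have := ltn_ord i; rewrite {2}n0.
by rewrite !mem0v.
Qed.

Lemma mem_flag_full W : flag W -> fullv \in W.
Proof. by case: W => [|U W] [//= _ -> _ _]; rewrite inE eqxx. Qed.

Lemma mem_flag_0 W : flag W -> 0%VS \in W.
Proof. by case: W => [|U W] [//= _ _ sl _]; rewrite -sl mem_last. Qed.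

Lemma strict_sorted_subseq W W' : sorted (@strict_sub R n) W ->
  sorted (@strict_sub R n) W' -> {subset W' <= W} -> subseq W' W.
Proof.
move=> sW sW' WW'; suff -> : W' = [seq U <- W | U \in W'] by exact: filter_subseq.
apply: (irr_sorted_eq (@strict_sub_trans R n) (@strict_sub_irr R n)) => //.
  exact: (sorted_filter (@strict_sub_trans R n)).
by move=> U; rewrite mem_filter; case: (boolP (U \in W')) => //= /WW' ->.
Qed.

Lemma flagseq_flag k phi : (0 < n)%N -> k \in unitmx -> nonincreasing_row phi ->
  flag (flagseq k phi).
Proof.
move=> n0 ku ninc; have ss := flagseq_sorted ku ninc; split => //.
- have : phi 0 (Ordinal n0) \in distinct_exponents phi.
    by apply/mem_distinct_exponents; exists (Ordinal n0).
  by rewrite size_rcons size_map ltnS; case: (distinct_exponents phi).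
- have : fullv \in flagseq k phi.
    apply/mem_flagseq => //; exists (phi 0 (Ordinal n0)).
    by rewrite /lowsp coordspT// => j; rewrite -leNgt ninc.
  case: (flagseq k phi) ss => //= U s ss; rewrite inE => /predU1P[//|fs].
  have /allP/(_ _ fs)/andP[fU _] := order_path_min (@strict_sub_trans R n) ss.
  by apply/eqP; rewrite eqEsubv fU subvf.
- by rewrite last_rcons.
Qed.

Lemma flag_eq_flagseq W k phi : flag W -> k \in unitmx -> nonincreasing_row phi ->
  (forall c, lowsp k phi c \in W) ->
  (forall U, U \in W -> exists c, U = lowsp k phi c) -> W = flagseq k phi.
Proof.
move=> fW ku ninc lW Wl; have n0 := flag_gt0 fW.
apply: (irr_sorted_eq (@strict_sub_trans R n) (@strict_sub_irr R n)).
- exact: flag_sorted.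
- exact: flagseq_sorted.
move=> U; apply/idP/idP => [/Wl UE|/mem_flagseq]; first exact/mem_flagseq.
by move=> /(_ n0 ku)[c ->]; exact: lW.
Qed.

(** A proper nonzero sublevel set is a tail starting at some d where phi drops from d - 1 to d. The
    member of W separating these two coordinates is itself a tail, and can only start at d. *)
Lemma lowsp_in_flag W k phi : flag W -> k \in unitmx -> nonincreasing_row phi ->
  (forall U, U \in W -> exists2 d, (d <= n)%N & U = tailsp k d) ->
  (forall i j, phi 0 j < phi 0 i ->
    exists U, [/\ U \in W, dualv k j \in U & dualv k i \notin U]) ->
  forall c, lowsp k phi c \in W.
Proof.
move=> fW ku ninc kW sep c.
have [d dn dP] : exists2 d, (d <= n)%N & forall j : 'I_n, (c < phi 0 j) = (j < d)%N.
  apply: downset_ord => i j ij cj; exact: lt_le_trans cj (ninc _ _ ij).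
have -> : lowsp k phi c = tailsp k d by exact: eq_coordsp.
have [d0|d0] := posnP d.
  by rewrite d0 /tailsp coordspT ?mem_flag_full.
move: dn; rewrite leq_eqVlt => /predU1P[->|dn].
  by rewrite /tailsp coordsp0 ?mem_flag_0.
have d1n : (d.-1 < n)%N by rewrite (leq_ltn_trans (leq_pred _)).
have [|U [UW]] := sep (Ordinal d1n) (Ordinal dn).
  apply: (@le_lt_trans _ _ c); last by rewrite dP/= prednK.
  by rewrite leNgt dP/= ltnn.
have [e _ UE] := kW U UW; rewrite UE in UW *.
rewrite !mem_dualv// negbK/= -leqNgt => ed; rewrite prednK// => de.
by have -> : d = e by apply/eqP; rewrite eqn_leq ed de.
Qed.

Lemma count_le (T : eqType) (s : seq T) (P Q : pred T) :
  {in s, subpred P Q} -> (count P s <= count Q s)%N.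
Proof.
move=> PQ; rewrite (@eq_in_count _ P [pred x | P x && Q x]) => [|x xs /=].
  by apply: sub_count => x /andP[].
by case: (boolP (P x)) => [/(PQ x xs) ->|].
Qed.

Lemma count_lt (T : eqType) (s : seq T) (P Q : pred T) x :
  {in s, subpred P Q} -> x \in s -> Q x -> ~~ P x -> (count P s < count Q s)%N.
Proof.
move=> PQ xs Qx Px; have /permP E := perm_to_rem xs.
rewrite !E/= Qx (negbTE Px) add0n add1n ltnS.
by apply: count_le => y /mem_rem /PQ.
Qed.

Lemma lowspZ g phi (s c : R) : 0 < s -> lowsp g (s *: phi) (s * c) = lowsp g phi c.
Proof. by move=> s0; apply: eq_coordsp => j; rewrite mxE ltr_pM2l. Qed.

Lemma nonincreasing_rowZ phi (s : R) : 0 < s -> nonincreasing_row phi ->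
  nonincreasing_row (s *: phi).
Proof. by move=> s0 ninc i j ij; rewrite !mxE ler_pM2l// ninc. Qed.

Lemma flagseqZ g phi (s : R) : (0 < n)%N -> g \in unitmx -> nonincreasing_row phi ->
  0 < s -> flagseq g (s *: phi) = flagseq g phi.
Proof.
move=> n0 gu ninc s0; apply: (@eq_flagseq _ _ _ _ _ _ s) => //.
  exact: nonincreasing_rowZ.
by move=> c; exact: lowspZ.
Qed.

(* Subtracting a positive multiple of it creates a jump at every step of W. *)
Definition flag_depth W k : 'rV[R]_n :=
  \row_j (count (fun U : {vspace 'cV[R]_n} => dualv k j \in U) W)%:R.

(** The depth is constant between steps of W and increases at each step. As phi drops only at steps
    of W, the difference drops at all of them and nowhere else, whatever the size of e. *)
Lemma perturbed_flagseq W k phi (e : R) : flag W -> k \in unitmx ->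
  (forall U, U \in W -> exists2 d, (d <= n)%N & U = tailsp k d) ->
  nonincreasing_row phi -> (forall c, lowsp k phi c \in W) -> 0 < e ->
  nonincreasing_row (phi - e *: flag_depth W k) /\
  W = flagseq k (phi - e *: flag_depth W k).
Proof.
move=> fW ku kW ninc lW e0; pose psi : 'rV[R]_n := phi - e *: flag_depth W k; rewrite -/psi.
pose chi (j : 'I_n) := count (fun U : {vspace 'cV[R]_n} => dualv k j \in U) W.
have psiE j : psi 0 j = phi 0 j - e * (chi j)%:R by rewrite !mxE.
have chi_le (i j : 'I_n) : (i <= j)%N ->
      {in W, forall U : {vspace 'cV[R]_n}, dualv k i \in U -> dualv k j \in U}.
  move=> ij U /kW[d _ ->]; rewrite !mem_dualv// -!leqNgt => di.
  exact: leq_trans ij.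
have ninc' : nonincreasing_row psi.
  move=> i j ij; rewrite !psiE lerB ?ninc// ler_pM2l// ler_nat.
  by apply: count_le; exact: chi_le.
split=> //; apply: flag_eq_flagseq => //.
  apply: lowsp_in_flag => // i j; rewrite !psiE => ij.
  have [pij|pij] := ltP (phi 0 j) (phi 0 i).
    exists (lowsp k phi (phi 0 j)); split; first exact: lW.
      by rewrite mem_dualv// ltxx.
    by rewrite mem_dualv// negbK.
  (* Here phi does not drop from i to j, so the drop of psi comes from the depth, and some member of
     W must separate the two coordinates. *)
  have /hasP[U UW /andP[jU iU]] : has (fun U : {vspace 'cV[R]_n} =>
      (dualv k j \in U) && (dualv k i \notin U)) W.
    apply: contraTT ij; rewrite -all_predC => /allP ji.
    rewrite -leNgt lerB// ler_pM2l// ler_nat; apply: count_le => U /ji/=.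
    by case: (dualv k j \in U) => //=; rewrite negbK.
  by exists U.
move=> U UW; have [d dn UE] := kW U UW.
suff [c cP] : exists c, forall j : 'I_n, (c < psi 0 j) = (j < d)%N.
  by exists c; rewrite UE; apply: eq_coordsp => j; rewrite cP.
move: dn; rewrite leq_eqVlt => /predU1P[->|dn].
  exists (\big[Num.min/0]_j psi 0 j - 1) => j.
  by rewrite ltn_ord ltrBlDr ltr_pwDr// bigmin_le_cond.
exists (psi 0 (Ordinal dn)) => j; have [jd|dj] := ltnP j d; last first.
  by apply/negbTE; rewrite -leNgt ninc'.
rewrite !psiE (@lt_le_trans _ _ (phi 0 (Ordinal dn) - e * (chi j)%:R))//.
  rewrite ltrD2l ltrN2 ltr_pM2l// ltr_nat; apply: count_lt UW _ _.
  - by apply: chi_le; exact: ltnW.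
  - by rewrite UE mem_dualv// -leqNgt.
  - by rewrite UE mem_dualv// negbK.
by rewrite lerD2r ninc// ltnW.
Qed.

End FlagFacts.

(** * Pencils and their velocities at E *)

Section Pencils.
Variables (R : realType) (n : nat).
Implicit Types (mu nu : R -> 'M[R]_n) (g h k : 'M[R]_n) (phi : 'rV[R]_n).
Implicit Types (l m : set (R -> 'M[R]_n)) (P : pencil R n).

Definition geod k phi (t : R) : 'M[R]_n := k *m expd phi t *m k^T.

Lemma geod_rep k phi : k \in unitmx -> nonincreasing_row phi -> phi != 0 ->
  geodesic_rep (geod k phi) k phi.
Proof. by move=> ku ninc phi0; split. Qed.

Lemma reparam_refl mu : reparam mu mu.
Proof.
by exists 1, 0; split=> //; apply/funext => t; rewrite mul1r addr0.
Qed.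

(** The factor a reflects the free speed of a directed geodesic. *)
Definition same_growth g phi h phi' : Prop :=
  exists2 a : R, 0 < a & forall c, lowsp g phi (a * c) = lowsp h phi' c.

Lemma same_growth_sym g phi h phi' :
  same_growth g phi h phi' -> same_growth h phi' g phi.
Proof.
move=> [a a0 aP]; exists a^-1; first by rewrite invr_gt0.
by move=> c; rewrite -aP mulVKf// gt_eqF.
Qed.

Lemma same_growth_trans g phi h phi' k psi : same_growth g phi h phi' ->
  same_growth h phi' k psi -> same_growth g phi k psi.
Proof.
move=> [a a0 aP] [b b0 bP]; exists (a * b); first exact: mulr_gt0.
by move=> c; rewrite -bP -aP mulrA.
Qed.

(** Taking b = 1 in [asymptotic_qr] shows that mu is asymptotic to itself, so independence of (g,
    phi) is a case of [asymptotic_lowsp]. *)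
Lemma same_growth_rep mu g phi h phi' :
  geodesic_rep mu g phi -> geodesic_rep mu h phi' -> same_growth g phi h phi'.
Proof.
move=> G H; apply: (asymptotic_lowsp G H).
have [gu ninc phi0 muE] := G.
have -> : mu = (fun t => (g *m 1%:M^T) *m expd phi t *m (g *m 1%:M^T)^T).
  by apply/funext => t; rewrite trmx1 mulmx1 muE.
have := asymptotic_qr gu (unitmx1 R n) (scalar_mx_is_trig n 1) ninc.
by rewrite trmx1 mulmx1.
Qed.

Lemma same_growth_reparam g phi (a b : R) : 0 < a ->
  same_growth (g *m expd phi b) (a *: phi) g phi.
Proof.
move=> a0; exists a => // c; apply/vspaceP => v.
have E j : ((g *m expd phi b)^T *m v) j 0 = expR (phi 0 j * b) * (g^T *m v) j 0.
  by rewrite trmx_mul tr_expd -mulmxA mul_diag_mx !mxE.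
apply/idP/idP => /coordspP H; apply/coordspP => j cj.
  have := H j; rewrite mxE ltr_pM2l// => /(_ cj)/eqP.
  by rewrite E mulf_eq0 gt_eqF ?expR_gt0//= => /eqP.
by rewrite E H ?mulr0//; move: cj; rewrite mxE ltr_pM2l.
Qed.

Lemma same_growth_directed l mu nu g phi h phi' : directed_geodesic l ->
  l mu -> l nu -> geodesic_rep mu g phi -> geodesic_rep nu h phi' ->
  same_growth g phi h phi'.
Proof.
move=> [mu0 [g0 [phi0 G0]] ->] lmu lnu G H.
have [a [b [a0 G1]]] := reparam_rep G0 lmu.
have [a' [b' [a'0 H1]]] := reparam_rep G0 lnu.
apply: (same_growth_trans (same_growth_rep G G1)).
apply: (same_growth_trans (same_growth_reparam _ _ _ a0)).
apply: same_growth_sym; apply: (same_growth_trans (same_growth_rep H H1)).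
exact: same_growth_reparam.
Qed.

Lemma directed_rep l mu : directed_geodesic l -> l mu ->
  exists g phi, geodesic_rep mu g phi.
Proof.
move=> [mu0 [g0 [phi0 G0]] ->] lmu.
have [a [b [a0 G1]]] := reparam_rep G0 lmu.
by exists (g0 *m expd phi0 (b / 2)), (a *: phi0).
Qed.

Lemma pencil_directed P l : sval P l -> directed_geodesic l.
Proof. by case: P => Q [l0 d0 QE] /=; rewrite QE => -[]. Qed.

(** Membership in P relates l and m only to the base geodesic l0, and only for some
    parametrizations; the comparison therefore runs from l through l0 to m, changing
    parametrizations on each. *)
Lemma pencil_growth P l m mu nu g phi h phi' : sval P l -> sval P m ->
  l mu -> m nu -> geodesic_rep mu g phi -> geodesic_rep nu h phi' ->
  same_growth g phi h phi'.
Proof.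
have [l0 d0 PE] := svalP P; rewrite PE => -[dl l0l] [dm l0m] lmu mnu G H.
have [mu1 [mu2 [l0mu1 lmu2 as12]]] := l0l.
have [nu1 [nu2 [l0nu1 mnu2 asnu12]]] := l0m.
have [g1 [phi1 G1]] := directed_rep d0 l0mu1.
have [g2 [phi2 G2]] := directed_rep dl lmu2.
have [h1 [psi1 H1]] := directed_rep d0 l0nu1.
have [h2 [psi2 H2]] := directed_rep dm mnu2.
apply: (same_growth_trans (same_growth_directed dl lmu lmu2 G G2)).
apply: (same_growth_trans (same_growth_sym (asymptotic_lowsp G1 G2 as12))).
apply: (same_growth_trans (same_growth_directed d0 l0mu1 l0nu1 G1 H1)).
apply: (same_growth_trans (asymptotic_lowsp H1 H2 asnu12)).
exact: same_growth_directed dm mnu2 mnu H2 H.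
Qed.

Definition sqnorm phi : R := \sum_j phi 0 j ^+ 2.

Lemma sqnorm_gt0 phi : phi != 0 -> 0 < sqnorm phi.
Proof.
move=> phi0; have [j pj] : exists j, phi 0 j != 0.
  apply/existsP; apply: contraR phi0; rewrite negb_exists => /forallP p0.
  by apply/eqP/rowP => j; rewrite [RHS]mxE; apply/eqP; have := p0 j; rewrite negbK.
rewrite /sqnorm (bigD1 j)//= ltr_pwDl ?exprn_even_gt0//.
by apply: sumr_ge0 => i _; rewrite sqr_ge0.
Qed.

Lemma sqnorm_neq0 phi : sqnorm phi = 1 -> phi != 0.
Proof.
move=> N1; apply/eqP => phi0; move: N1; rewrite /sqnorm phi0 big1.
  by move/eqP; rewrite eq_sym oner_eq0.
by move=> j _; rewrite mxE expr0n.
Qed.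

Lemma sqnormZ (s : R) phi : sqnorm (s *: phi) = s ^+ 2 * sqnorm phi.
Proof. by rewrite /sqnorm big_distrr/=; apply: eq_bigr => j _; rewrite mxE exprMn. Qed.

Lemma trace_sqr_spectral k phi : k^T *m k = 1%:M ->
  \tr ((k *m diag_mx phi *m k^T) *m (k *m diag_mx phi *m k^T)) = sqnorm phi.
Proof.
move=> kk; rewrite !mulmxA -(mulmxA _ k^T) kk mulmx1 mxtrace_mulC !mulmxA kk mul1mx.
rewrite mulmx_diag mxtrace_diag; apply: eq_bigr => j _.
by rewrite mxE expr2.
Qed.

(** Normal form of a pencil: orthonormality of k puts [geod k phi] at E at time 0, and
    [sqnorm phi = 1] makes its velocity there a unit vector. *)
Definition represents P k phi : Prop :=
  [/\ k^T *m k = 1%:M, nonincreasing_row phi, sqnorm phi = 1 &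
      exists2 l, sval P l & l (geod k phi)].

Lemma represents_rep P k phi : represents P k phi ->
  geodesic_rep (geod k phi) k phi.
Proof.
move=> [kk ninc N1 _]; apply: geod_rep => //; last exact: sqnorm_neq0.
exact: orthonormal_unit.
Qed.

Lemma normalized_ray k phi : phi != 0 ->
  reparam (geod k phi) (geod k ((Num.sqrt (sqnorm phi))^-1 *: phi)) /\
  sqnorm ((Num.sqrt (sqnorm phi))^-1 *: phi) = 1.
Proof.
move=> /sqnorm_gt0 N0; have sN0 : 0 < Num.sqrt (sqnorm phi) by rewrite sqrtr_gt0.
split; last by rewrite sqnormZ exprVn sqr_sqrtr ?ltW// mulVf// gt_eqF.
exists (Num.sqrt (sqnorm phi))^-1, 0; split; first by rewrite invr_gt0.
apply/funext => t; rewrite /geod /expd; congr (_ *m diag_mx _ *m _).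
apply/rowP => j; rewrite !mxE addr0; congr expR.
by rewrite mulrCA mulrA.
Qed.

Lemma represents_ex P : exists k phi, represents P k phi.
Proof.
have [l0 [mu0 [g [phi [gu ninc phi0 mu0E]]] ->] PE] := svalP P.
have [k [b [kk bu bt gE]]] := qr_decomposition gu.
have ku := orthonormal_unit kk.
have [ray N1] := normalized_ray k phi0.
exists k, ((Num.sqrt (sqnorm phi))^-1 *: phi); split=> //.
  by apply: nonincreasing_rowZ => //; rewrite invr_gt0 sqrtr_gt0 sqnorm_gt0.
exists (reparam (geod k phi)) => //; rewrite PE; split.
  by exists (geod k phi) => //; exists k, phi; exact: geod_rep.
exists mu0, (geod k phi); split; [exact: reparam_refl|exact: reparam_refl|].
have -> : mu0 = (fun t => (k *m b^T) *m expd phi t *m (k *m b^T)^T).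
  by apply/funext => t; rewrite mu0E gE.
exact: asymptotic_qr.
Qed.

Lemma represents_make k phi : k^T *m k = 1%:M -> nonincreasing_row phi ->
  sqnorm phi = 1 -> exists P, represents P k phi.
Proof.
move=> kk ninc N1; have ku := orthonormal_unit kk.
have dl : directed_geodesic (reparam (geod k phi)).
  by exists (geod k phi) => //; exists k, phi; apply: geod_rep => //; exact: sqnorm_neq0.
have fP : finite_pencil [set m | directed_geodesic m /\
    same_finite_pencil (reparam (geod k phi)) m].
  by exists (reparam (geod k phi)).
exists (exist _ _ fP); split=> //; exists (reparam (geod k phi)); last exact: reparam_refl.
split=> //=; exists (geod k phi), (geod k phi); split; try exact: reparam_refl.
have := asymptotic_qr ku (unitmx1 R n) (scalar_mx_is_trig n 1) ninc.
by rewrite trmx1 mulmx1.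
Qed.

Lemma represents_velocity_at P k phi : represents P k phi ->
  unit_velocity_at_E P (k *m diag_mx phi *m k^T).
Proof.
move=> [kk ninc N1 [l Pl lk]]; exists l, (geod k phi); split=> //.
- by rewrite /geod expd0 mulmx1 orthonormal_tr.
- by have [] := is_derive1_mx (is_derive_geodesic k phi).
- by rewrite trace_sqr_spectral.
Qed.

(** mu(0) = 1 forces g g^T = 1, so a geodesic parametrized to pass through E at time 0 already has
    an orthonormal frame. *)
Lemma velocity_at_represents P A : unit_velocity_at_E P A ->
  exists k phi, represents P k phi /\ A = k *m diag_mx phi *m k^T.
Proof.
move=> [l [mu [Pl lmu mu0 dmu trA]]].
have [g [phi [gu ninc phi0 muE]]] := directed_rep (pencil_directed Pl) lmu.
have muG : mu = geod g phi by apply/funext.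
have gg : g^T *m g = 1%:M.
  by apply: mulmx1C; rewrite -mu0 muG /geod expd0 mulmx1.
have AE : A = g *m diag_mx phi *m g^T.
  by rewrite -dmu muG; have [] := is_derive1_mx (is_derive_geodesic g phi).
exists g, phi; split=> //; split=> //; first by rewrite -trA AE trace_sqr_spectral.
by exists l => //; rewrite -muG.
Qed.

Lemma spectral_id k phi : spectral k phi id = k *m diag_mx phi *m k^T.
Proof. by rewrite /spectral; congr (_ *m diag_mx _ *m _); apply/rowP => j; rewrite mxE. Qed.

(** Equal growth up to the factor a makes one velocity a times the other; both have norm 1 and a >
    0, so a = 1. *)
Lemma represents_unique P k phi k' phi' :
  represents P k phi -> represents P k' phi' ->
  k *m diag_mx phi *m k^T = k' *m diag_mx phi' *m k'^T.
Proof.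
move=> r r'; have [kk ninc N1 [l Pl lk]] := r; have [kk' ninc' N1' [l' Pl' lk']] := r'.
have [a a0 aP] := pencil_growth Pl Pl' lk lk' (represents_rep r) (represents_rep r').
have E c : lowsp k phi c = lowsp k' (a *: phi') c.
  by rewrite -[c](mulVKf (lt0r_neq0 a0)) lowspZ// -aP.
have := spectral_of_lowsp kk kk' E id; rewrite !spectral_id => AE.
have := trace_sqr_spectral phi kk; rewrite AE trace_sqr_spectral// N1 sqnormZ N1' mulr1.
move=> /eqP; rewrite sqrf_eq1 => /orP[/eqP->|/eqP am1]; first by rewrite scale1r.
by move: a0; rewrite am1 ltr0N1.
Qed.

Lemma represents_velocity P k phi : represents P k phi ->
  unit_velocity P = k *m diag_mx phi *m k^T.
Proof.
move=> r; apply: xget_subset1; first exact: represents_velocity_at.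
move=> A B /velocity_at_represents[kA [phiA [rA ->]]].
move=> /velocity_at_represents[kB [phiB [rB ->]]].
exact: represents_unique rA rB.
Qed.

Lemma represents_change P k phi : k^T *m k = 1%:M -> nonincreasing_row phi ->
  unit_velocity P = k *m diag_mx phi *m k^T -> represents P k phi.
Proof.
move=> kk ninc uE; have [k0 [phi0 r0]] := represents_ex P.
have u0E := represents_velocity r0; have [kk0 _ N0 [l Pl lk0]] := r0.
split=> //.
  rewrite -N0 -(trace_sqr_spectral phi kk) -(trace_sqr_spectral phi0 kk0).
  by rewrite -u0E -uE.
exists l => //; suff -> : geod k phi = geod k0 phi0 by [].
apply/funext => t; apply: (spectral_of_id kk kk0 _ (fun x => expR (x * t))).
by rewrite !spectral_id -uE -u0E.
Qed.

(** All geodesics of P have the same sublevel sets up to scaling, so the quantifier over geodesics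
    in [Delta] is decided on the normal form. *)
Lemma Delta_represents P k phi W : (0 < n)%N -> represents P k phi ->
  Delta W P <-> W = flagseq k phi.
Proof.
move=> n0 r; have G := represents_rep r; have [kk ninc N1 [l Pl lk]] := r.
have ku := orthonormal_unit kk.
split=> [/(_ l Pl)[mu [g [phi' [lmu G']]]]|-> m Pm].
  have [gu ninc' _ _] := G'; move=> /limit_flag_repE -> //.
  have [a a0 aP] := pencil_growth Pl Pl lk lmu G G'.
  by apply/esym/(eq_flagseq n0 gu ninc' ku ninc a0).
have [mu [g [phi' G']] mE] := pencil_directed Pm.
have mmu : m mu by rewrite mE; exact: reparam_refl.
have [gu ninc' _ _] := G'; exists mu, g, phi'; split=> //; apply/limit_flag_repE => //.
have [a a0 aP] := pencil_growth Pm Pl mmu lk G' G.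
exact/esym/(eq_flagseq n0 ku ninc gu ninc' a0).
Qed.

End Pencils.

(** * The closure of a stratum *)

Section Closure.
Variables (R : realType) (n : nat).
Implicit Types (k : 'M[R]_n) (phi : 'rV[R]_n) (W : seq {vspace 'cV[R]_n}).

Lemma closure_le0 (T : topologicalType) (D : set T) (f : T -> R) (x : T) :
  {for x, continuous f} -> (forall y, D y -> f y <= 0) -> closure D x -> f x <= 0.
Proof.
move=> fx D0 Dx; rewrite leNgt; apply/negP => fx0.
have nf : \forall y \near x, 0 < f y by apply: (cvgr_gt (f x)); [exact: fx|exact: fx0].
have [y [/D0]] := Dx _ nf.
by rewrite /= leNgt => /negP.
Qed.

Lemma velocity_entry_continuous k (i j : 'I_n) :
  continuous (fun P : Sfar R n => (k^T *m unit_velocity P *m k) i j).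
Proof.
move=> P; have uc : unit_velocity Q @[Q --> (P : Sfar R n)] --> unit_velocity P.
  exact: initial_continuous.
pose F := nbhs (P : Sfar R n); have FF : Filter F by exact: nbhs_filter.
have c1 : k^T *m unit_velocity Q @[Q --> F] --> k^T *m unit_velocity P.
  by apply: (@cvg_mulmx _ _ F FF _ _ _ (fun=> k^T)) => //; exact: cvg_cst.
have /(@cvg_mxP _ _ F FF) : k^T *m unit_velocity Q *m k @[Q --> F] -->
    k^T *m unit_velocity P *m k.
  by apply: (@cvg_mulmx _ _ F FF _ _ _ _ (fun=> k)) => //; exact: cvg_cst.
exact.
Qed.

(** Moves the normal form to a basis depending on W alone, so that different pencils can be compared
    entry by entry. *)
Lemma adapted_represents W P k k0 phi0 : k^T *m k = 1%:M ->
  (forall U, U \in W -> exists2 d, (d <= n)%N & U = tailsp k d) ->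
  represents P k0 phi0 -> (forall c, lowsp k0 phi0 c \in W) ->
  exists2 phi, represents P k phi & forall c, lowsp k phi c = lowsp k0 phi0 c.
Proof.
move=> kk kW r lW; have [kk0 _ _ _] := r.
have [|phi ninc E] := @adapted_exponents _ _ k0 phi0 k
    (orthonormal_unit kk0) (orthonormal_unit kk).
  by move=> c; have [d _] := kW _ (lW c); exists d.
exists phi => //; apply: represents_change => //.
by rewrite (represents_velocity r) -!spectral_id; apply: spectral_of_lowsp.
Qed.

(** In the basis k, membership in Delta(W) implies equalities and nonstrict inequalities between
    entries of the velocity. These survive in the closure, whereas the strictness of a drop may be
    lost; the surviving drops form the subflag. *)
Lemma closure_Delta_sub W (P : Sfar R n) : flag W -> closure (Delta W) P ->
  exists2 W', subflag W' W & Delta W' P.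
Proof.
move=> fW clP; have n0 := flag_gt0 fW.
have [k kk kW] := flag_orthonormal_basis fW; have ku := orthonormal_unit kk.
pose X (Q : Sfar R n) := k^T *m unit_velocity Q *m k.
have DX (Q : Sfar R n) : Delta W Q -> exists phi,
    [/\ nonincreasing_row phi, X Q = diag_mx phi & forall c, lowsp k phi c \in W].
  move=> DQ; have [k0 [phi0 r]] := represents_ex Q.
  have [kk0 ninc0 _ _] := r.
  move/(Delta_represents W n0 r): DQ => WE.
  have lW c : lowsp k0 phi0 c \in W.
    by rewrite WE; apply/mem_flagseq => //; [exact: orthonormal_unit|exists c].
  have [phi rphi E] := adapted_represents kk kW r lW.
  exists phi; split; [by case: rphi| |by move=> c; rewrite E].
  by rewrite /X (represents_velocity rphi) !mulmxA kk mul1mx -mulmxA kk mulmx1.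
have cX i j : {for P, continuous (fun Q => X Q i j)} by exact: velocity_entry_continuous.
have offdiag i j : i != j -> X P i j = 0.
  move=> ij; apply/eqP; rewrite eq_le; apply/andP; split.
    apply: (closure_le0 (cX i j) _ clP) => Q /DX[phi [_ -> _]].
    by rewrite mxE (negbTE ij) mulr0n.
  rewrite -oppr_le0; apply: (closure_le0 (f := fun Q => - X Q i j) _ _ clP).
    exact: cvgN (cX i j).
  by move=> Q /DX[phi [_ -> _]]; rewrite mxE (negbTE ij) mulr0n oppr0.
have ninc (i j : 'I_n) : (i <= j)%N -> X P j j <= X P i i.
  move=> ij; rewrite -subr_le0.
  apply: (closure_le0 (f := fun Q => X Q j j - X Q i i) _ _ clP).
    exact: cvgB (cX j j) (cX i i).
  by move=> Q /DX[phi [ninc -> _]]; rewrite !mxE !eqxx !mulr1n subr_le0 ninc.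
have blocks i j : (forall U, U \in W -> dualv k j \in U -> dualv k i \in U) ->
    X P i i <= X P j j.
  move=> ij; rewrite -subr_le0.
  apply: (closure_le0 (f := fun Q => X Q i i - X Q j j) _ _ clP).
    exact: cvgB (cX i i) (cX j j).
  move=> Q /DX[phi [_ -> lW]]; rewrite !mxE !eqxx !mulr1n subr_le0.
  have := ij _ (lW (phi 0 j)); rewrite !mem_dualv// ltxx => /(_ isT).
  by rewrite -leNgt.
pose phi := \row_j X P j j.
have XE : X P = diag_mx phi.
  apply/matrixP => i j; rewrite [RHS]mxE; have [->|ij] := eqVneq i j.
    by rewrite ?eqxx mulr1n [RHS]mxE.
  by rewrite offdiag// mulr0n.
have ninc_phi : nonincreasing_row phi by move=> i j ij; rewrite [leLHS]mxE [leRHS]mxE ninc.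
have r : represents P k phi.
  apply: represents_change => //; rewrite -XE /X !mulmxA (orthonormal_tr kk) mul1mx.
  by rewrite -mulmxA (orthonormal_tr kk) mulmx1.
have lW c : lowsp k phi c \in W.
  apply: lowsp_in_flag => // i j ij; apply/not_existsP => H.
  move: ij; rewrite ltNge [phi 0 i]mxE [phi 0 j]mxE => /negP; apply.
  apply: blocks => U UW jU.
  by apply/negPn/negP => iU; apply: (H U).
exists (flagseq k phi); last exact/(Delta_represents _ n0 r).
split; first exact: flagseq_flag.
apply: strict_sorted_subseq; [exact: flag_sorted|exact: flagseq_sorted|].
by move=> U /mem_flagseq -/(_ n0 ku)[c ->]; exact: lW.
Qed.

Lemma Delta_sub_closure W W' (P : Sfar R n) : flag W -> subflag W' W ->
  Delta W' P -> closure (Delta W) P.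
Proof.
move=> fW [fW' sub] DP; have n0 := flag_gt0 fW.
have [k kk kW] := flag_orthonormal_basis fW; have ku := orthonormal_unit kk.
have [k0 [phi0 r0]] := represents_ex P; have [kk0 ninc0 _ _] := r0.
move/(Delta_represents W' n0 r0): DP => WE.
have lW0 c : lowsp k0 phi0 c \in W.
  apply: (mem_subseq sub); rewrite WE; apply/mem_flagseq => //.
    exact: orthonormal_unit.
  by exists c.
have [phi r E] := adapted_represents kk kW r0 lW0.
have lW c : lowsp k phi c \in W by rewrite E.
have [_ ninc N1 _] := r.
pose psi (e : R) : 'rV[R]_n := phi - e *: flag_depth W k.
(* Rescaled to unit length because velocities live on the unit sphere; the norm of psi(e) tends to
   1, so the limit is still phi. *)
pose chi (e : R) := (Num.sqrt (sqnorm (psi e)))^-1 *: psi e.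
have cpsi j : psi e 0 j @[e --> 0^'+] --> phi 0 j.
  have psiE e : psi e 0 j = phi 0 j - e * flag_depth W k 0 j by rewrite !mxE.
  have : phi 0 j - e * flag_depth W k 0 j @[e --> 0^'+] -->
      phi 0 j - 0 * flag_depth W k 0 j.
    apply: cvgB; first exact: cvg_cst.
    by apply: cvgM; [exact: cvg_within|exact: cvg_cst].
  by rewrite mul0r subr0 (funext psiE).
have cN : sqnorm (psi e) @[e --> 0^'+] --> (1 : R).
  rewrite -N1; apply: cvg_sumr => j _.
  by apply: (cvgM (cpsi j) (cpsi j)).
have csN : (Num.sqrt (sqnorm (psi e)))^-1 @[e --> 0^'+] --> (1 : R).
  rewrite -[X in _ --> X]invr1; apply: cvgV; first exact: oner_neq0.
  rewrite -[X in _ --> X]sqrtr1.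
  apply: (cvg_comp _ (@Num.sqrt R) cN); exact: sqrt_continuous.
have cvel : k *m diag_mx (chi e) *m k^T @[e --> 0^'+] --> unit_velocity P.
  rewrite (represents_velocity r).
  have cd : diag_mx (chi e) @[e --> 0^'+] --> diag_mx phi.
    apply/cvg_mxP => i j; rewrite mxE.
    have chiE e : diag_mx (chi e) i j =
        ((Num.sqrt (sqnorm (psi e)))^-1 * psi e 0 i) *+ (i == j).
      by rewrite mxE /chi mxE.
    rewrite (funext chiE); case: eqP => [_|_]; last first.
      by rewrite mulr0n; under eq_fun do rewrite mulr0n; exact: cvg_cst.
    rewrite mulr1n -[X in _ --> X]mul1r; under eq_fun do rewrite mulr1n.
    exact: cvgM.
  have c1 : k *m diag_mx (chi e) @[e --> 0^'+] --> k *m diag_mx phi.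
    by apply: (@cvg_mulmx _ _ _ _ _ _ _ (fun=> k)) => //; exact: cvg_cst.
  by apply: (@cvg_mulmx _ _ _ _ _ _ _ _ (fun=> k^T)) => //; exact: cvg_cst.
(* A neighbourhood in the initial topology contains the preimage of an open set C of matrices, so it
   suffices to find a pencil of Delta(W) with velocity in C. *)
move=> B [_ [[C oC <-] CP CB]].
have nC : \forall e \near 0^'+, C (k *m diag_mx (chi e) *m k^T).
  by apply: cvel; exact: open_nbhs_nbhs.
have Ngt0 : \forall e \near 0^'+, 0 < sqnorm (psi e).
  by apply: (cvgr_gt (1 : R) cN); exact: ltr01.
near (0 : R)^'+ => e.
have e0 : 0 < e by near: e; exact: nbhs_right_gt.
have Ne : 0 < sqnorm (psi e) by near: e.
have Ce : C (k *m diag_mx (chi e) *m k^T) by near: e.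
have [npsi Wpsi] := perturbed_flagseq fW ku kW ninc lW e0.
have psi0 : psi e != 0.
  apply: contraTneq Ne => ->; rewrite /sqnorm big1 ?ltxx// => j _.
  by rewrite mxE expr0n.
have [_ Nchi] := normalized_ray k psi0.
have s0 : 0 < (Num.sqrt (sqnorm (psi e)))^-1 by rewrite invr_gt0 sqrtr_gt0.
have [Q rQ] := represents_make kk (nonincreasing_rowZ s0 npsi) Nchi.
exists Q; split.
  apply/(Delta_represents W n0 rQ); rewrite flagseqZ//.
by apply: CB; rewrite /preimage/= (represents_velocity rQ).
Unshelve. all: by end_near. Qed.

End Closure.

Theorem proposition4p2 (R : realType) (n : nat) (W : seq {vspace 'cV[R]_n})
    (hW : flag W) :
  closure (Delta W) = \bigcup_(W' in [set W' | subflag W' W]) Delta W'.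
Proof.
apply/seteqP; split=> [P clP|P [W' sW' DP]].
  by have [W' sW' DP] := closure_Delta_sub hW clP; exists W'.
exact: Delta_sub_closure sW' DP.
Qed.
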